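(* Let $K$ be a finite or countable set, let $\kappa$ be a probability measure on $K$, and let $\mathbb F_2=\langle a,b\rangle$ be the free group of rank 2. Then the Bernoulli shift action $\mathbb F_2\curvearrowright(K^{\mathbb F_2},\kappa^{\mathbb F_2})$ is orbit equivalent to the shift action $\mathbb F_2\curvearrowright\big((K\times K)^{\mathbb F_2},\kappa^{\mathbb F_2/\langle b\rangle}\times\kappa^{\mathbb F_2}\big)$.
   Context: For a set $L$, $\mathbb F_2$ acts on $L^{\mathbb F_2}$ by the shift action $(g\cdot x)(f)=x(g^{-1}f)$. Let $\mathbb F_2/\langle b\rangle$ be the set of left cosets $g\langle b\rangle$. Measure $\kappa^{\mathbb F_2/\langle b\rangle}\times\kappa^{\mathbb F_2}$ on $(K\times K)^{\mathbb F_2}$: define the injection $\Phi:K^{\mathbb F_2/\langle b\rangle}\times K^{\mathbb F_2}\to(K\times K)^{\mathbb F_2}$ by $\Phi(x,y)(g)=\big(x(g\langle b\rangle),y(g)\big)$. Identify $K^{\mathbb F_2/\langle b\rangle}\times K^{\mathbb F_2}$ with its image under $\Phi$. The notation $\kappa^{\mathbb F_2/\langle b\rangle}\times\kappa^{\mathbb F_2}$ denotes the push-forward under $\Phi$ of the product measure, so the complement of the image has measure $0$. Orbit equivalence: two p.m.p. actions $G_1\curvearrowright^T(X_1,\mu_1)$, $G_2\curvearrowright^S(X_2,\mu_2)$ of countable groups on standard probability spaces are orbit equivalent if there are conull sets $X_i'\subset X_i$ and a measurable bijection $\phi:X_1'\to X_2'$ with measurable inverse such that $\phi_*\mu_1=\mu_2$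 and, for every $x\in X_1'$, $\phi(\{T_gx:g\in G_1\}\cap X_1')=\{S_g\phi(x):g\in G_2\}\cap X_2'$. *)

(* Defs.v *)
From HB Require Import structures.
From mathcomp Require Import all_boot all_order all_algebra.
From mathcomp Require Import all_classical all_reals all_analysis.
From mathcomp Require Import measurable_realfun.

Set Implicit Arguments.
Unset Strict Implicit.
Unset Printing Implicit Defensive.
Import Order.TTheory GRing.Theory Num.Theory.
Import numFieldNormedType.Exports.

Local Open Scope classical_set_scope.

(* (false, _) is the generator a, (true, _) is b; the second component is true
   for the formal inverse of the generator. *)
Notation letter := (bool * bool)%type.

Definition linv (l : letter) : letter := (l.1, ~~ l.2).

Definition reduced (w : seq letter) : bool :=
  sorted (fun l l' => l' != linv l) w.

Record F2 : Type := MkF2 { word : seq letter; word_reduced : reduced word }.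
HB.instance Definition _ := [isSub for word].
HB.instance Definition _ := [Countable of F2 by <:].

Definition push (l : letter) (w : seq letter) : seq letter :=
  if w is l' :: w' then (if l' == linv l then w' else l :: w) else [:: l].

Lemma linvK : involutive linv.
Proof. by case=> ? ?; rewrite /linv /= negbK. Qed.

Lemma push_reduced l w : reduced w -> reduced (push l w).
Proof.
case: w => [//|l' w]; rewrite /push; case: eqP => [_|/eqP ne] /=.
  exact: path_sorted.
by rewrite /reduced /= ne.
Qed.

Lemma pushK l w : reduced w -> push (linv l) (push l w) = w.
Proof.
case: w => [|l' w] /=; first by rewrite linvK eqxx.
case: eqP => [->|/eqP ne] rw /=; last by rewrite linvK eqxx.
by case: w rw => [//|l2 w] /= /andP[/negPf ->].
Qed.

Lemma foldr_push_reduced u w : reduced w -> reduced (foldr push w u).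
Proof. by move=> rw; elim: u => //= l u; exact: push_reduced. Qed.

Lemma foldr_push_push l u w : reduced u -> reduced w ->
  foldr push w (push l u) = push l (foldr push w u).
Proof.
move=> ru rw; case: u ru => [//|l' u] ru; rewrite [push l (l' :: u)]/push.
have [->|//] := eqVneq l' (linv l); rewrite [foldr _ _ (_ :: _)]/=.
by rewrite -{1}(linvK l) pushK// foldr_push_reduced.
Qed.

Lemma foldr_pushA u v w : reduced v -> reduced w ->
  foldr push w (foldr push v u) = foldr push (foldr push w v) u.
Proof.
move=> rv rw; elim: u => //= l u IHu.
by rewrite foldr_push_push ?IHu// foldr_push_reduced.
Qed.

Lemma foldr_push_nil u : reduced u -> foldr push [::] u = u.
Proof.
elim: u => //= l u IHu ru; rewrite IHu; last exact: path_sorted ru.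
by case: u ru {IHu} => //= l' u /andP[/negPf ->].
Qed.

Lemma reduced_inv w : reduced w -> reduced (rev (map linv w)).
Proof.
rewrite /reduced rev_sorted sorted_map; apply: sub_sorted => l l' /=.
by apply: contra => /eqP ->; rewrite linvK.
Qed.

Lemma foldr_push_inv u w : reduced w ->
  foldr push (foldr push w u) (rev (map linv u)) = w.
Proof.
elim: u w => //= l u IHu w rw.
by rewrite rev_cons -cats1 foldr_cat /= pushK ?IHu// foldr_push_reduced.
Qed.

Definition F2_one : F2 := @MkF2 [::] isT.
Definition F2_mul (u v : F2) : F2 :=
  MkF2 (foldr_push_reduced (word u) (word_reduced v)).
Definition F2_inv (u : F2) : F2 := MkF2 (reduced_inv (word_reduced u)).

Lemma F2_mulA : associative F2_mul.
Proof.
by move=> u v w; apply/val_inj; rewrite /= foldr_pushA// word_reduced.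
Qed.

Lemma F2_mul1 : left_id F2_one F2_mul.
Proof. by move=> u; apply/val_inj. Qed.

Lemma F2_mulr1 : right_id F2_one F2_mul.
Proof. by move=> u; apply/val_inj/foldr_push_nil/word_reduced. Qed.

Lemma F2_mulV : left_inverse F2_one F2_inv F2_mul.
Proof.
move=> u; apply/val_inj => /=.
by rewrite -{1}(foldr_push_nil (word_reduced u)) foldr_push_inv.
Qed.

Lemma F2_invK : involutive F2_inv.
Proof.
move=> u; apply/val_inj; rewrite /= map_rev revK -map_comp map_id_in// => l _.
exact: linvK.
Qed.

Lemma F2_mulrV : right_inverse F2_one F2_inv F2_mul.
Proof. by move=> u; rewrite -{1}(F2_invK u) F2_mulV. Qed.

HB.instance Definition _ :=
  isGroup.Build F2 F2_mulA F2_mul1 F2_mulr1 F2_mulV F2_mulrV.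

Definition gen_a : F2 := @MkF2 [:: (false, false)] isT.
Definition gen_b : F2 := @MkF2 [:: (true, false)] isT.

Definition cyc_b : set F2 :=
  [set h | exists n : nat, h = (gen_b ^+ n)%g \/ h = (gen_b ^- n)%g].

(* The set F_2 / <b> of left cosets g<b>, literally as a set of subsets. *)
Definition lcoset_b (g : F2) : set F2 := [set (g * h)%g | h in cyc_b].
Definition F2modb : Type := set_type (range lcoset_b).
HB.instance Definition _ := Choice.on F2modb.

Definition coset_b (g : F2) : F2modb :=
  @exist _ (fun A => A \in range lcoset_b) (lcoset_b g)
    (mem_set (imageT lcoset_b g)).

Lemma coset_b_surj (c : F2modb) : exists g, coset_b g = c.
Proof. by case: c => A Ac; have [g _ gA] := set_mem Ac; exists g; exact: val_inj. Qed.

Definition coset_b_rep (c : F2modb) : F2 := sval (cid (coset_b_surj c)).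
Lemma coset_b_repK : cancel coset_b_rep coset_b.
Proof. by move=> c; exact: (svalP (cid (coset_b_surj c))). Qed.
HB.instance Definition _ : isCountable F2modb := CanIsCountable coset_b_repK.

(* measurableType includes a point; any K carrying a probability measure is
   nonempty, so this is no restriction on K. *)
HB.mixin Record isCountableDiscrete d T & Measurable d T := {
  countable_carrier : countable [set: T] ;
  discrete_measurableE : forall A : set T, measurable A }.

#[short(type="countableDiscreteType")]
HB.structure Definition CountableDiscrete d :=
  {T of Measurable d T & isCountableDiscrete d T}.

Definition coord_sets (I : Type) d (L : measurableType d) : set (set (I -> L)) :=
  [set C | exists i, exists2 B, measurable B & C = (fun x => x i) @^-1` B].

(* L^I with the product sigma-algebra, generated by the coordinate maps. *)
Definition prod_space (I : Type) d (L : measurableType d) : Type :=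
  g_sigma_algebraType (@coord_sets I d L).

HB.instance Definition _ (I : Type) d (L : measurableType d) :=
  Measurable.on (prod_space I L).

Lemma measurable_coord (I : Type) d (L : measurableType d) (i : I) (B : set L) :
  measurable B -> measurable ([set x | B (x i)] : set (prod_space I L)).
Proof. by move=> mB; apply: sub_sigma_algebra; exists i; exists B. Qed.

Lemma measurable_fun_prod_space d' (X : measurableType d') (I : Type) d
    (L : measurableType d) (f : X -> prod_space I L) :
  (forall i, measurable_fun setT (fun x => f x i)) -> measurable_fun setT f.
Proof.
move=> mf.
apply: (@measurability _ _ X (prod_space I L) setT f (@coord_sets I d L)) => //.
by move=> _ [_ [i [B mB ->]] <-]; exact: mf.
Qed.

Definition is_product (I : choiceType) d (L : measurableType d) (R : realType)
    (kappa : probability L R) (mu : set (prod_space I L) -> \bar R) : Prop :=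
  forall (s : seq I) (A : I -> set L), uniq s -> (forall i, measurable (A i)) ->
  mu [set x | forall i, i \in s -> A i (x i)] = (\prod_(i <- s) kappa (A i))%E.

(* Existence of the product over nat.  [prefix_pr n] is the law of a sequence
   whose first n coordinates are independent of law kappa and whose other
   coordinates are constant; these laws define a sigma-additive content on the
   algebra of sets depending on finitely many coordinates. *)
Section product_nat.
Context d (K : countableDiscreteType d) (R : realType) (kappa : probability K R).
Local Open Scope ereal_scope.

Let measurable_all (f : K -> \bar R) : measurable_fun setT f.
Proof. by move=> _ Y mY; exact: discrete_measurableE. Qed.

Definition scons (k : K) (x : nat -> K) : nat -> K :=
  fun n => if n is m.+1 then x m else k.

Fixpoint prefix_pr (n : nat) (A : set (nat -> K)) : \bar R :=
  if n is m.+1 then \int[kappa]_k prefix_pr m (scons k @^-1` A)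
  else (\1_A (fun=> point))%:E.

Definition depends (n : nat) (A : set (nat -> K)) : Prop :=
  forall x y, (forall i, (i < n)%N -> x i = y i) -> A x -> A y.

Lemma depends_le n p A : (n <= p)%N -> depends n A -> depends p A.
Proof. by move=> np dA x y xy; apply: dA => i /leq_trans/(_ np); exact: xy. Qed.

Lemma depends_scons n k A : depends n.+1 A -> depends n (scons k @^-1` A).
Proof. by move=> dA x y xy; apply: dA => -[//|i]; exact: xy. Qed.

Definition cylinder_algebra : Type := nat -> K.
HB.instance Definition _ := Pointed.on cylinder_algebra.

Definition cylinder : set (set cylinder_algebra) := [set A | exists n, depends n A].

Lemma cylinder0 : cylinder set0.
Proof. by exists 0%N. Qed.

Lemma cylinderU : setU_closed cylinder.
Proof.
move=> A B [n dA] [p dB]; exists (maxn n p) => x y xy [Ax|Bx]; [left|right].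
  exact: depends_le (leq_maxl n p) dA _ _ xy Ax.
exact: depends_le (leq_maxr n p) dB _ _ xy Bx.
Qed.

Lemma cylinderC : setC_closed cylinder.
Proof.
move=> A [n dA]; exists n => x y xy nAx Ay; apply: nAx; apply: dA Ay => i lin.
by rewrite xy.
Qed.

HB.instance Definition _ := isAlgebraOfSets.Build default_measure_display
  cylinder_algebra cylinder0 cylinderU cylinderC.

Lemma prefix_pr_ge0 n A : 0 <= prefix_pr n A.
Proof.
elim: n A => [|n IHn] A /=; first by rewrite lee_fin.
by apply: integral_ge0 => k _; exact: IHn.
Qed.

Lemma prefix_pr0 n : prefix_pr n set0 = 0.
Proof.
elim: n => [|n IHn] /=; first by rewrite indic0.
by under eq_integral do rewrite preimage_set0 IHn; rewrite integral0.
Qed.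

Lemma prefix_prT n : prefix_pr n setT = 1.
Proof.
elim: n => [|n IHn] /=; first by rewrite indicT.
under eq_integral do rewrite preimage_setT IHn.
by rewrite integral_cst// mul1e; exact: probability_setT.
Qed.

Lemma prefix_prU n A B : A `&` B = set0 ->
  prefix_pr n (A `|` B) = prefix_pr n A + prefix_pr n B.
Proof.
elim: n A B => [|n IHn] A B AB /=.
  rewrite -EFinD !indicE in_setU; congr (_%:E).
  case: (boolP (_ \in A)) => [/set_mem Ax|_]; case: (boolP (_ \in B)) => [/set_mem Bx|_];
    rewrite ?addr0 ?add0r//.
  by have : (A `&` B) (fun=> point) by []; rewrite AB.
rewrite -ge0_integralD//; try by move=> k _; exact: prefix_pr_ge0.
apply: eq_integral => k _; rewrite preimage_setU IHn//.
by rewrite -preimage_setI AB preimage_set0.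
Qed.

Lemma prefix_pr_depends n p A : (n <= p)%N -> depends n A ->
  prefix_pr p A = prefix_pr n A.
Proof.
elim: n p A => [|n IHn] p A np dA; last first.
  case: p np => [//|p] np /=; apply: eq_integral => k _.
  by apply: IHn => //; exact: depends_scons.
have [Ap|nAp] := pselect (A (fun=> point)).
  rewrite (_ : A = setT) ?prefix_prT//.
  by apply/seteqP; split => // x _; apply: dA Ap.
rewrite (_ : A = set0) ?prefix_pr0//.
by apply/seteqP; split => // x Ax; apply: nAp; apply: dA Ax.
Qed.

Definition cylinder_pr (A : set cylinder_algebra) : \bar R :=
  prefix_pr (xget 0%N (fun n => depends n A)) A.

Lemma cylinder_prE n A : depends n A -> cylinder_pr A = prefix_pr n A.
Proof.
move=> dA; rewrite /cylinder_pr.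
have dX : depends (xget 0%N (fun n => depends n A)) A.
  by apply: (@xgetPex _ 0%N (fun n => depends n A)); exists n.
have [le|/ltnW le] := leqP n (xget 0%N (fun n => depends n A)).
  exact: prefix_pr_depends.
by rewrite -(prefix_pr_depends le dX).
Qed.

Lemma cylinder_pr_ge0 A : 0 <= cylinder_pr A.
Proof. exact: prefix_pr_ge0. Qed.

Lemma cylinder_pr0 : cylinder_pr set0 = 0.
Proof. exact: prefix_pr0. Qed.

Lemma cylinder_prT : cylinder_pr setT = 1.
Proof. exact: prefix_prT. Qed.

Lemma cylinder_pr_additive : measure_function.semi_additive cylinder_pr.
Proof.
apply/additive2P; first exact: cylinder_pr0.
move=> A B [n dA] [p dB] AB.
have dA' := depends_le (leq_maxl n p) dA.
have dB' := depends_le (leq_maxr n p) dB.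
have dAB : depends (maxn n p) (A `|` B).
  by move=> x y xy [Ax|Bx]; [left; exact: dA' Ax|right; exact: dB' Bx].
by rewrite (cylinder_prE dA') (cylinder_prE dB') (cylinder_prE dAB) prefix_prU.
Qed.

HB.instance Definition _ := isContent.Build _ cylinder_algebra R cylinder_pr
  cylinder_pr_ge0 cylinder_pr_additive.

Lemma cylinder_scons k (A : set cylinder_algebra) :
  measurable A -> measurable (scons k @^-1` A : set cylinder_algebra).
Proof.
move=> [n dA]; exists n; apply: depends_scons.
exact: depends_le (leqnSn n) dA.
Qed.

Lemma cylinder_pr_scons (A : set cylinder_algebra) : measurable A ->
  cylinder_pr A = \int[kappa]_k cylinder_pr (scons k @^-1` A).
Proof.
move=> [n dA]; have dA' := depends_le (leqnSn n) dA.
rewrite (cylinder_prE dA') /=; apply: eq_integral => k _.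
by rewrite (cylinder_prE (depends_scons (k:=k) dA')).
Qed.

Let bad (A : set cylinder_algebra) (F : nat -> set cylinder_algebra) :=
  \sum_(i <oo) cylinder_pr (F i) < cylinder_pr A.

Let bad_scons A F : measurable A -> (forall i, measurable (F i)) -> bad A F ->
  exists k, bad (scons k @^-1` A) (fun i => scons k @^-1` F i).
Proof.
move=> mA mF; apply: contraPP => /forallNP nb; apply/negP; rewrite -leNgt.
rewrite (cylinder_pr_scons mA).
under eq_eseriesr do rewrite cylinder_pr_scons//.
rewrite -integral_nneseries//.
apply: ge0_le_integral => // k _.
by rewrite leNgt; apply/negP; exact: nb.
Qed.

(* [glue w x] prepends the reverse of the finite word w to x. *)
Let glue (w : seq K) (x : nat -> K) : nat -> K :=
  foldl (fun x k => scons k x) x w.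

Lemma cylinder_pr_subadditive : measurable_subset_sigma_subadditive cylinder_pr.
Proof.
move=> A F mF mA AF; rewrite leNgt; apply/negP => b0.
pose P (w : seq K) := bad (glue w @^-1` A) (fun i => glue w @^-1` F i).
have mglue w (B : set cylinder_algebra) : measurable B ->
    measurable (glue w @^-1` B : set cylinder_algebra).
  elim: w B => [|k w IHw] B mB //; rewrite (_ : _ @^-1` B = scons k @^-1` (glue w @^-1` B)).
    by apply: cylinder_scons; exact: IHw.
  by [].
have step w : {k | P w -> P (k :: w)}.
  have [Pw|nPw] := pselect (P w); last by exists point.
  have [k bk] := cid (bad_scons (mglue w _ mA) (fun i => mglue w _ (mF i)) Pw).
  by exists k.
pose W := fix W n : seq K := if n is m.+1 then sval (step (W m)) :: W m else [::].
have PW n : P (W n).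
  by elim: n => [|n IHn]; [exact: b0|exact: (svalP (step (W n)) IHn)].
pose x n := sval (step (W n)).
have glueW n (y : nat -> K) i : glue (W n) y i = if (i < n)%N then x i else y (i - n)%N.
  elim: n y i => [|n IHn] y i; first by rewrite subn0.
  rewrite -[LHS]/(glue (W n) (scons (x n) y) i) IHn.
  case: ltngtP => [lt|lt|->].
  - by rewrite ltnS ltnW.
  - rewrite ltnS leqNgt lt /=.
    by rewrite (_ : i - n = (i - n.+1).+1)%N// subnSK.
  - by rewrite ltnS leqnn subnn.
have full (B : set cylinder_algebra) n : depends n B -> B x -> forall p, (n <= p)%N -> glue (W p) @^-1` B = setT.
  move=> dB Bx p np; apply/seteqP; split => // y _; apply: dB Bx => i lin.
  by rewrite glueW (leq_trans lin np).
have [n dA] := mA.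
have Ax : A x.
  apply: contrapT => nAx; have := PW n; rewrite /P /bad.
  rewrite (_ : glue (W n) @^-1` A = set0).
    rewrite cylinder_pr0; apply/negP; rewrite -leNgt.
    by apply: nneseries_ge0 => i _ _; exact: cylinder_pr_ge0.
  apply/seteqP; split => // y Ay; apply: nAx; apply: dA Ay => i lin.
  by rewrite glueW lin.
have [j _ Fx] := AF _ Ax; have [p dF] := mF j.
have := PW (maxn n p); rewrite /P /bad (full _ _ dA Ax) ?leq_maxl//.
apply/negP; rewrite -leNgt.
rewrite (le_trans _ (nneseries_lim_ge j.+1 _))//.
rewrite big_nat_recr//= (full _ _ dF Fx) ?leq_maxr//.
by rewrite leeDr// sume_ge0// => i _; exact: cylinder_pr_ge0.
Qed.

HB.instance Definition _ := Content_SigmaSubAdditive_isMeasure.Build _ R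
  cylinder_algebra cylinder_pr cylinder_pr_subadditive.

Definition product_nat := measure_extension cylinder_pr.
HB.instance Definition _ := Measure.on product_nat.

Lemma product_natE A : cylinder A -> product_nat A = cylinder_pr A.
Proof. by move=> cA; rewrite /product_nat /measure_extension measurable_mu_extE. Qed.

Lemma product_natT : product_nat setT = 1.
Proof. by rewrite product_natE ?cylinder_prT//; exists 0%N. Qed.

HB.instance Definition _ := Measure_isProbability.Build _ _ _ product_nat
  product_natT.

Lemma cylinder_pr_prod n (B : nat -> set K) :
  cylinder_pr [set x | forall i, (i < n)%N -> B i (x i)] =
  \prod_(i < n) kappa (B i).
Proof.
rewrite (@cylinder_prE n); last first.
  by move=> x y xy Bx i lin; rewrite -xy//; exact: Bx.
elim: n B => [|n IHn] B.
  rewrite big_ord0 (_ : mkset _ = setT) ?prefix_prT//.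
  by apply/seteqP; split.
rewrite big_ord_recl -(IHn (fun i => B i.+1)) /=.
set c := prefix_pr n _.
transitivity (\int[kappa]_k (c * (\1_(B 0%N) k)%:E)).
  apply: eq_integral => k _; rewrite indicE.
  case: (boolP (k \in B 0%N)) => [/set_mem Bk|/negP nBk].
    rewrite mule1; congr (prefix_pr n _).
    apply/seteqP; split => x /= Bx; last by move=> [//|i] lin; exact: Bx.
    by move=> i lin; exact: (Bx i.+1).
  rewrite mule0 (_ : _ @^-1` _ = set0) ?prefix_pr0//.
  apply/seteqP; split => // x /= Bx; apply: nBk; apply/mem_set.
  exact: (Bx 0%N).
rewrite ge0_integralZl//; last exact: prefix_pr_ge0.
rewrite integral_indic; [|exact: discrete_measurableE..].
by rewrite setIT muleC.
Qed.

End product_nat.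

Section product_exists.
Context (I : countType) d (K : countableDiscreteType d) (R : realType).
Variable kappa : probability K R.
Local Open Scope ereal_scope.

Let cyl := g_sigma_algebraType (@cylinder d K).
Let reindex (x : cyl) : prod_space I K := fun i => x (pickle i).

Let mreindex : measurable_fun setT reindex.
Proof.
apply: measurable_fun_prod_space => i _ B mB; rewrite setTI.
apply: sub_sigma_algebra; exists (pickle i).+1 => x y xy.
by rewrite /= /reindex xy.
Qed.

HB.instance Definition _ := isMeasurableFun.Build _ _ _ _ reindex mreindex.

Lemma product_probability_exists :
  exists mu : probability (prod_space I K) R, is_product kappa mu.
Proof.
exists (distribution (product_nat kappa) reindex) => s A us _.
pose S := map pickle s; pose n := (\max_(j <- S) j.+1)%N.
have Sn j : j \in S -> (j < n)%N by move=> jS; rewrite /n (big_rem j)//= leq_maxl.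
have uS : uniq S by rewrite map_inj_uniq//; exact: pcan_inj pickleK.
pose B j := [set k | forall i, i \in s -> pickle i = j -> A i k].
have BA i : i \in s -> B (pickle i) = A i.
  move=> si; apply/seteqP; split => k; first exact.
  by move=> Ak i' _ /(pcan_inj pickleK) ->.
have BT j : j \notin S -> B j = setT.
  move=> jS; apply/seteqP; split => // k _ i si ij.
  by case/negP: jS; rewrite -ij map_f.
rewrite -[LHS]/(product_nat kappa
  (reindex @^-1` [set x | forall i, i \in s -> A i (x i)])).
rewrite (_ : _ @^-1` _ = [set x | forall j, (j < n)%N -> B j (x j)]); last first.
  apply/seteqP; split => x /= Hx.
    by move=> j _ i si <-; exact: Hx.
  move=> i si; rewrite -BA//; apply: Hx; apply: Sn; exact: map_f.
rewrite product_natE; last first.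
  by exists n => x y xy Bx j jn; rewrite -xy//; exact: Bx.
rewrite cylinder_pr_prod.
transitivity (\prod_(j <- S) kappa (B j)); last first.
  by rewrite big_map big_seq [RHS]big_seq; apply: eq_bigr => i /BA ->.
rewrite -(big_mkord xpredT (fun j => kappa (B j))) (bigID (mem S))/=.
rewrite [X in _ * X]big1 ?mule1; last first.
  by move=> j jS; rewrite BT ?probability_setT.
rewrite -big_filter; apply: perm_big; apply: uniq_perm => //.
  by rewrite filter_uniq// iota_uniq.
move=> j; rewrite mem_filter mem_index_iota /=.
by apply/andP/idP => [[]//|jS]; split => //; exact: Sn.
Qed.

End product_exists.

(* The product measure kappa^I; it is unique by [is_product_unique]. *)
Definition product_probability (I : countType) d (K : countableDiscreteType d)
    (R : realType) (kappa : probability K R) : probability (prod_space I K) R :=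
  sval (cid (product_probability_exists I kappa)).

Lemma product_probabilityP (I : countType) d (K : countableDiscreteType d)
    (R : realType) (kappa : probability K R) :
  is_product kappa (product_probability I kappa).
Proof. exact: (svalP (cid (product_probability_exists I kappa))). Qed.

Section product_unique.
Context (I : choiceType) d (L : measurableType d) (R : realType).
Variable kappa : probability L R.

Let boxes : set (set (prod_space I L)) :=
  [set C | exists s, exists2 A : I -> set L, uniq s /\ (forall i, measurable (A i)) &
     C = [set x | forall i, i \in s -> A i (x i)]].

Let measurable_box (s : seq I) (A : I -> set L) : (forall i, measurable (A i)) ->
  measurable ([set x | forall i, i \in s -> A i (x i)] : set (prod_space I L)).
Proof.
move=> mA; elim: s => [|j s IHs].
  rewrite (_ : mkset _ = setT); first exact: measurableT.
  by apply/seteqP; split.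
rewrite (_ : mkset _ = [set x | A j (x j)] `&`
  [set x | forall i, i \in s -> A i (x i)]).
  by apply: measurableI => //; exact: measurable_coord.
apply/seteqP; split=> [x H|x [Hj H] i].
  by split=> [|i si]; apply: H; rewrite inE ?eqxx// si orbT.
by rewrite inE => /orP[/eqP ->|/H].
Qed.

Lemma is_product_unique (mu nu : probability (prod_space I L) R) :
  is_product kappa mu -> is_product kappa nu ->
  forall A, measurable A -> mu A = nu A.
Proof.
move=> pmu pnu A mA.
apply: (@measure_unique _ R (prod_space I L) boxes (fun=> setT)) => //.
- apply/seteqP; split.
    apply: smallest_sub; first exact: smallest_sigma_algebra.
    move=> _ [i [B mB ->]]; apply: sub_sigma_algebra.
    exists [:: i]; exists (fun=> B) => //.
    apply/seteqP; split => x /=; first by move=> Bx j; rewrite inE => /eqP ->.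
    by apply; rewrite inE.
  apply: smallest_sub; first exact: smallest_sigma_algebra.
  by move=> _ [s [B [_ mB] ->]]; exact: measurable_box.
- move=> _ _ [s [B [us mB] ->]] [t [C [ut mC] ->]].
  exists (undup (s ++ t)), (fun i => (if i \in s then B i else setT) `&`
                                 (if i \in t then C i else setT)).
    split=> [|i]; first exact: undup_uniq.
    by apply: measurableI; case: ifP.
  apply/seteqP; split=> [x [Bx Cx] i _|x H].
    by split; case: ifPn => // it; [exact: Bx|exact: Cx].
  split=> i it; have := H i; rewrite mem_undup mem_cat it ?orbT => /(_ isT)[];
    by rewrite ?it.
- move=> _; exists [::]; exists (fun=> setT) => //.
  by apply/seteqP; split.
- by rewrite bigcup_const.
- by move=> _ [s [B [us mB] ->]]; exact: etrans (pmu s B us mB) (esym (pnu s B us mB)).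
- by move=> _; rewrite [X in (X < _)%E]probability_setT ltry.
Qed.

End product_unique.

Section reindex.
Context (I : countType) d (K : countableDiscreteType d) (R : realType).
Variables (kappa : probability K R) (e : I -> I) (e_inj : injective e).

Let reindex (x : prod_space I K) : prod_space I K := fun i => x (e i).

Lemma measurable_reindex : measurable_fun setT reindex.
Proof.
apply: measurable_fun_prod_space => i _ B mB; rewrite setTI.
exact: measurable_coord.
Qed.
HB.instance Definition _ := isMeasurableFun.Build _ _ _ _ reindex measurable_reindex.

Lemma product_probability_reindex A : measurable A ->
  product_probability I kappa (reindex @^-1` A) = product_probability I kappa A.
Proof.
move=> mA; apply: (is_product_unique (kappa := kappa)
  (mu := distribution (product_probability I kappa) reindex)) => //; last first.
  exact: product_probabilityP.
move=> s B us mB.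
pose C j := [set k | forall i, i \in s -> e i = j -> B i k].
have CB i : i \in s -> C (e i) = B i.
  move=> si; apply/seteqP; split => k; first exact.
  by move=> Bk i' _ /e_inj ->.
transitivity (\prod_(j <- map e s) kappa (C j))%E; last first.
  by rewrite big_map big_seq [RHS]big_seq; apply: eq_bigr => i /CB ->.
rewrite -(product_probabilityP kappa (s := map e s) (A := C)); last 2 first.
- by rewrite map_inj_uniq.
- by move=> j; exact: discrete_measurableE.
rewrite -[LHS]/(product_probability I kappa
  (reindex @^-1` [set x | forall i, i \in s -> B i (x i)])).
congr (product_probability I kappa _); apply/seteqP; split => x /= H.
  by move=> _ /mapP[i si ->] i' si' /e_inj <-; rewrite /= in H *; exact: H.
by move=> i si; rewrite -CB//; apply: H; exact: map_f.
Qed.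

End reindex.

Record pmp_action (G : groupType) d (X : measurableType d) (R : realType)
    (mu : probability X R) : Type := PmpAction {
  act :> G -> X -> X ;
  act1 : forall x, act 1%g x = x ;
  actM : forall g h x, act (g * h)%g x = act g (act h x) ;
  measurable_act : forall g, measurable_fun setT (act g) ;
  act_preserving : forall g A, measurable A -> mu (act g @^-1` A) = mu A }.

Definition act_orbit (G : groupType) d (X : measurableType d) (R : realType)
    (mu : probability X R) (T : pmp_action G mu) (x : X) : set X :=
  [set T g x | g in [set: G]].

(* [phi] and its inverse [psi] are total functions, but only their restrictions
   to the conull sets X1' and X2' matter. *)
Definition orbit_equivalent (R : realType)
    (G1 : groupType) d1 (X1 : measurableType d1) (mu1 : probability X1 R)
    (T : pmp_action G1 mu1)
    (G2 : groupType) d2 (X2 : measurableType d2) (mu2 : probability X2 R)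
    (S : pmp_action G2 mu2) : Prop :=
  exists (X1' : set X1) (X2' : set X2) (phi : X1 -> X2) (psi : X2 -> X1),
    [/\ measurable X1' /\ mu1 (~` X1') = 0%E,
        measurable X2' /\ mu2 (~` X2') = 0%E,
        [/\ {homo phi : x / X1' x >-> X2' x},
            {homo psi : y / X2' y >-> X1' y},
            (forall x, X1' x -> psi (phi x) = x) &
            (forall y, X2' y -> phi (psi y) = y)],
        measurable_fun X1' phi /\ measurable_fun X2' psi &
        (forall B, measurable B -> mu1 (X1' `&` phi @^-1` B) = mu2 (X2' `&` B)) /\
        (forall x, X1' x ->
           phi @` (act_orbit T x `&` X1') = act_orbit S (phi x) `&` X2')].

Definition shift (d : measure_display) (L : measurableType d) (g : F2)
    (x : prod_space F2 L) : prod_space F2 L := fun f => x (g^-1 * f)%g.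

Section shift.
Context d (L : measurableType d).
Local Open Scope group_scope.

Lemma shift1 (x : prod_space F2 L) : shift 1 x = x.
Proof. by apply/funext => f; rewrite /shift invg1 mul1g. Qed.

Lemma shiftM g h (x : prod_space F2 L) : shift (g * h) x = shift g (shift h x).
Proof. by apply/funext => f; rewrite /shift invgM mulgA. Qed.

Lemma measurable_shift g : measurable_fun setT (@shift d L g).
Proof.
apply: measurable_fun_prod_space => i _ B mB; rewrite setTI.
exact: measurable_coord.
Qed.

End shift.

Section shift_actions.
Context (R : realType) d (K : countableDiscreteType d) (kappa : probability K R).
Local Open Scope group_scope.

Let mulVg_inj (g : F2) : injective (fun f : F2 => g^-1 * f).
Proof. by move=> f f' /mulgI. Qed.

Lemma bernoulli_preserving (g : F2) (A : set (prod_space F2 K)) : measurable A ->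
  product_probability F2 kappa (shift g @^-1` A) = product_probability F2 kappa A.
Proof. exact: (product_probability_reindex kappa (mulVg_inj (g := g))). Qed.

Definition bernoulli_shift : pmp_action F2 (product_probability F2 kappa) :=
  PmpAction (@shift1 _ K) (@shiftM _ K) (@measurable_shift _ K) bernoulli_preserving.

Definition coset_pair (xy : prod_space F2modb K * prod_space F2 K) :
    prod_space F2 (K * K)%type :=
  fun g => (xy.1 (coset_b g), xy.2 g).

Lemma measurable_coset_pair : measurable_fun setT coset_pair.
Proof.
apply: measurable_fun_prod_space => g; apply: measurable_fun_pair.
  apply: (@measurableT_comp _ _ _ _ _ _ (fun x : prod_space F2modb K => x (coset_b g))) => //.
  by move=> _ B mB; rewrite setTI; exact: measurable_coord.
apply: (@measurableT_comp _ _ _ _ _ _ (fun x : prod_space F2 K => x g)) => //.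
by move=> _ B mB; rewrite setTI; exact: measurable_coord.
Qed.

HB.instance Definition _ :=
  isMeasurableFun.Build _ _ _ _ coset_pair measurable_coset_pair.

Definition product_pair : probability (prod_space F2modb K * prod_space F2 K)%type R :=
  (product_probability F2modb kappa \x product_probability F2 kappa)%E.

Definition coset_bernoulli : probability (prod_space F2 (K * K)%type) R :=
  distribution product_pair coset_pair.

Let act_coset (g : F2) (c : F2modb) : F2modb := coset_b (g^-1 * coset_b_rep c).

Let act_cosetE g f : act_coset g (coset_b f) = coset_b (g^-1 * f).
Proof.
have lcM h k : lcoset_b (h * k) = [set h * l | l in lcoset_b k].
  rewrite /lcoset_b image_comp; apply: eq_imagel => l _ /=.
  by rewrite mulgA.
apply: val_inj; rewrite /= !lcM; congr (image _ _).
by have := coset_b_repK (coset_b f) => /(congr1 val).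
Qed.

Let act_coset_inj g : injective (act_coset g).
Proof.
apply: (can_inj (g := act_coset g^-1)) => c.
by rewrite {2}/act_coset act_cosetE invgK mulgA mulgV mul1g coset_b_repK.
Qed.

Let act_pair (g : F2) (xy : prod_space F2modb K * prod_space F2 K) :
  prod_space F2modb K * prod_space F2 K :=
  (fun c => xy.1 (act_coset g c), shift g xy.2).

Let measurable_act_pair g : measurable_fun setT (act_pair g).
Proof.
apply: measurable_fun_pair.
  by apply: (measurableT_comp (@measurable_reindex F2modb _ K (act_coset g))).
by apply: (measurableT_comp (@measurable_shift _ K g)).
Qed.

HB.instance Definition _ g :=
  isMeasurableFun.Build _ _ _ _ (act_pair g) (measurable_act_pair g).

Lemma coset_bernoulli_preserving (g : F2) (A : set (prod_space F2 (K * K)%type)) :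
  measurable A -> coset_bernoulli (shift g @^-1` A) = coset_bernoulli A.
Proof.
move=> mA.
have mB : measurable (coset_pair @^-1` A).
  by rewrite -[X in measurable X]setTI; exact: measurable_coset_pair.
rewrite -[RHS]/(product_pair (coset_pair @^-1` A)).
rewrite -[LHS]/(product_pair (coset_pair @^-1` (shift g @^-1` A))).
rewrite (_ : coset_pair @^-1` (shift g @^-1` A) =
             act_pair g @^-1` (coset_pair @^-1` A)); last first.
  apply: (congr1 (fun h => h @^-1` A)); apply/funext => xy; apply/funext => f.
  by rewrite /shift /coset_pair /= act_cosetE.
apply/esym; apply: (@product_measure_unique _ _ _ _ R
  (product_probability F2modb kappa) (product_probability F2 kappa)
  (distribution product_pair (act_pair g))) => // B C mB' mC.
rewrite -[LHS]/((product_probability F2modb kappa \x product_probability F2 kappa)%E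
  (((fun x : prod_space F2modb K => fun c => x (act_coset g c)) @^-1` B) `*`
   (@shift d K g @^-1` C))).
rewrite product_measure1E.
- congr (_ * _)%E; first exact: product_probability_reindex (act_coset_inj (g := g)) _ mB'.
  exact: bernoulli_preserving.
- rewrite -[X in measurable X]setTI; exact: measurable_reindex.
- rewrite -[X in measurable X]setTI; exact: measurable_shift.
Qed.

Definition coset_bernoulli_shift : pmp_action F2 coset_bernoulli :=
  PmpAction (@shift1 _ (K * K)%type) (@shiftM _ (K * K)%type)
    (@measurable_shift _ (K * K)%type) coset_bernoulli_preserving.

End shift_actions.

(* Main.v *)
(* Read z in K^F2 as giving every vertex g of the Cayley tree a slot labelled
   z(g) and an open end of the b-edge arriving from g b^-1, labelled
   z(g b^-1).  On each coset of <a> the slots and the open ends carry two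
   independent i.i.d. label sequences, and matching them greedily, equal label
   with equal label, is almost surely perfect: otherwise there would be, with
   positive probability, a last unmatched slot of some label, and its position
   would be uniformly distributed on Z.  Moving every b-edge to the slot its
   open end is matched with yields a new action of F2 with the same orbits, for
   which z is constant along b-lines; the old end labels are the second
   coordinate, and they allow the matching to be undone.
   The law of the relabelled process is shift invariant by mass transport, and
   given the label of the b-edge from 1 to b the two sides of that edge are
   conditionally independent.  These properties, which the target law shares,
   determine it from its restriction to <a>, which is i.i.d. *)
From HB Require Import structures.
Require Import Defs.
From mathcomp Require Import all_boot all_order all_algebra.
From mathcomp Require Import all_classical all_reals all_analysis.
From mathcomp Require Import measurable_realfun.

Set Implicit Arguments.
Unset Strict Implicit.
Unset Printing Implicit Defensive.
Import Order.TTheory GRing.Theory Num.Theory.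

Local Open Scope classical_set_scope.

(** * Words *)

Section words.
Local Open Scope group_scope.

(** In the target the first label is common to a whole [b]-line, whereas the Bernoulli labels at the
    two ends of a [b]-edge are independent; this is why edges have to be moved. Keeping the arrival
    of each edge inside one coset of [<a>] preserves orbits, because [a] itself is left unchanged.
    The new position of an edge depends on an unbounded number of labels, so the joint law of the
    relabelled process is out of reach of direct computation. What remains under control is
    locality: a moved edge arrives in the same coset of [<a>] as before, so the two sides of the
    edge from 1 to [b] stay separated, and the far side learns from the near side only the label of
    1. Statements about a single sample are proved under the pointwise hypothesis that its matching
    is perfect; probability enters only to show that this holds almost surely and to identify the
    law. *)

Definition letter_elt (l : letter) : F2 := @MkF2 [:: l] isT.

Lemma letter_elt_linv l : letter_elt (linv l) = (letter_elt l)^-1.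
Proof. exact/val_inj. Qed.

Lemma letter_eltE l :
  letter_elt l = (if l.1 then if l.2 then gen_b^-1 else gen_b
                  else if l.2 then gen_a^-1 else gen_a).
Proof. by case: l => [[] []]; exact/val_inj. Qed.

Lemma word_mul g h : word (g * h) = foldr push (word h) (word g).
Proof. by []. Qed.

Lemma word1 : word 1 = [::].
Proof. by []. Qed.

Lemma F2_consE l w (r : reduced (l :: w)) (r' : reduced w) :
  MkF2 r = letter_elt l * MkF2 r'.
Proof.
by apply/val_inj; rewrite /= -{1}(foldr_push_nil r) /= foldr_push_nil.
Qed.

Lemma F2_rconsE w l (r : reduced (rcons w l)) (r' : reduced w) :
  MkF2 r = MkF2 r' * letter_elt l.
Proof.
apply/val_inj; rewrite -[LHS](foldr_push_nil r) -cats1 foldr_cat.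
by case: l r.
Qed.

Lemma reduced_rcons w l : reduced (rcons w l) -> reduced w.
Proof. by rewrite -cats1; case: w => //= x w; rewrite /reduced /= cat_path => /andP[]. Qed.

(** Induction along the edges of the Cayley tree. The premise that the new vertex differs from 1
    excludes a step back to the root, as the locality proofs require. *)
Lemma F2_ind_right (P : F2 -> Prop) : P 1 ->
  (forall g l, g * letter_elt l != 1 -> P g -> P (g * letter_elt l)) ->
  forall g, P g.
Proof.
move=> P1 PS [w rw]; elim/last_ind: w rw => [|w l IH] rw.
  by rewrite (_ : MkF2 rw = 1)//; exact/val_inj.
have rw' := reduced_rcons rw.
rewrite (F2_rconsE rw rw'); apply: PS => //.
rewrite -(F2_rconsE rw); apply/eqP => /(congr1 word)/(congr1 size).
by rewrite word1 size_rcons.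
Qed.

Lemma word_mul_letter g l :
  word (g * letter_elt l) = rcons (word g) l \/
  word g = rcons (word (g * letter_elt l)) (linv l).
Proof.
case: g => w rw; case/lastP: w rw => [|w l'] rw; first by left.
have rw' := reduced_rcons rw.
have [ll'|ll'] := eqVneq l' (linv l).
  right; rewrite (F2_rconsE rw rw') ll' letter_elt_linv mulgVK.
  by rewrite -letter_elt_linv -(F2_rconsE (l := linv l) (w := w)) -?ll'.
left; have r : reduced (rcons (rcons w l') l).
  case: w rw {rw'} => [|x w] /= rw; first by rewrite andbT -(inv_eq linvK) eq_sym.
  rewrite rcons_path rw last_rcons /=.
  by apply: contra ll' => /eqP ->; rewrite linvK.
by rewrite -(F2_rconsE r).
Qed.

(* The half of the Cayley tree lying beyond the edge from 1 to b. *)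
Definition half_b (g : F2) : bool := ohead (word g) == Some (true, false).

(** Right multiplication by a letter changes only the end of the reduced word, so the first letter
    survives unless one of the two words is empty. *)
Lemma half_b_letter g l : g != 1 -> g * letter_elt l != 1 ->
  half_b (g * letter_elt l) = half_b g.
Proof.
have ohead_rcons (x : letter) (w : seq letter) :
  w != [::] -> ohead (rcons w x) = ohead w by case: w.
have word_neq1 (h : F2) : h != 1 -> word h != [::].
  by apply: contra => /eqP h1; apply/eqP/val_inj.
move=> g1 gl1; rewrite /half_b.
case: (word_mul_letter g l) => ->; rewrite ohead_rcons//; exact: word_neq1.
Qed.

Lemma half_b1 : half_b 1 = false. Proof. by []. Qed.

(** The edge from 1 to [gen_b] is the only edge of the tree that changes sides. *)
Lemma half_b_mulb g : half_b (g * gen_b) = half_b g || (g == 1).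
Proof.
have [->|g1] := eqVneq g 1; first by rewrite mul1g orbT.
have [gb1|gb1] := eqVneq (g * gen_b) 1.
  by rewrite gb1 (_ : g = gen_b^-1)// -(mulg1_eq gb1) invgK.
by rewrite orbF (half_b_letter (l := (true, false))).
Qed.

Lemma half_b_mulbV g : half_b g = half_b (g * gen_b^-1) || (g == gen_b).
Proof.
rewrite -{1}[g](mulgVK gen_b) half_b_mulb; congr (_ || _).
by rewrite mulg_eq1 invgK.
Qed.

Lemma half_b_mula g : half_b (g * gen_a) = half_b g.
Proof.
have [->//|g1] := eqVneq g 1.
have [ga1|ga1] := eqVneq (g * gen_a) 1.
  by rewrite ga1 (_ : g = gen_a^-1)// -(mulg1_eq ga1) invgK.
by rewrite (half_b_letter (l := (false, false))).
Qed.

Lemma half_b_mulaV g : half_b (g * gen_a^-1) = half_b g.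
Proof. by rewrite -half_b_mula mulgVK. Qed.

Definition in_a (g : F2) : bool := all (fun l : letter => ~~ l.1) (word g).

Lemma in_aM g h : in_a g -> in_a h -> in_a (g * h).
Proof.
rewrite /in_a word_mul; elim: (word g) => //= l w IH /andP[la wa] ha.
have := IH wa ha; case: (foldr _ _ _) => [|l' w'] /=; first by rewrite la.
by move=> /andP[l'a w'a]; case: ifP => //= _; rewrite la l'a.
Qed.

Lemma in_a1 : in_a 1. Proof. by []. Qed.
Lemma in_a_genV : in_a gen_a^-1. Proof. by []. Qed.

Lemma in_a_exp n : in_a (gen_a ^+ n).
Proof. by elim: n => // n IH; rewrite expgS in_aM. Qed.

Lemma in_aV g : in_a g -> in_a g^-1.
Proof.
by rewrite /in_a [word g^-1]/(rev (map linv (word g))) all_rev all_map.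
Qed.

Lemma in_a_expV n : in_a (gen_a ^- n).
Proof. exact/in_aV/in_a_exp. Qed.

Lemma in_a_ind (Q : F2 -> Prop) u : Q u ->
  (forall v, Q v -> Q (v * gen_a)) -> (forall v, Q v -> Q (v * gen_a^-1)) ->
  forall w, in_a w -> Q (u * w).
Proof.
move=> Qu Qa QaV [w rw]; elim: w rw u Qu => [|l w IH] rw u Qu.
  by rewrite (_ : MkF2 rw = 1) ?mulg1//; exact/val_inj.
rewrite {1}/in_a [word _]/=.
have rw' : reduced w by exact: path_sorted rw.
case/andP=> la wa; rewrite (F2_consE rw rw') mulgA; apply: IH => //.
case: l la {rw wa} => [[] []]//= _; rewrite letter_eltE /=; [exact: QaV|exact: Qa].
Qed.

End words.

(** * The greedy matching along the cosets of a *)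

Section matching.
Local Open Scope group_scope.
Context (K : eqType).
Implicit Types (w : F2 -> K * K) (g h : F2).

(* Position g carries an open end labelled (w g).2 and a slot labelled (w g).1.
   At stage k the open end of g is matched to the slot of g a^k whenever both
   are still unmatched and carry the same label. *)
Definition matches (u : (F2 -> bool) * (F2 -> bool)) w k g :=
  [&& u.1 g, u.2 (g * gen_a ^+ k) & (w g).2 == (w (g * gen_a ^+ k)).1].

Fixpoint unmatched w k : (F2 -> bool) * (F2 -> bool) :=
  if k is j.+1 then
    let u := unmatched w j in
    (fun g => u.1 g && ~~ matches u w j g,
     fun g => u.2 g && ~~ matches u w j (g * gen_a ^- j))
  else (xpredT, xpredT).

Definition matched w k := matches (unmatched w k) w k.

Lemma unmatched1P w k g :
  reflect (forall j, (j < k)%N -> ~~ matched w j g) ((unmatched w k).1 g).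
Proof.
elim: k => [|k IH] /=; first by left.
apply: (iffP andP) => [[/IH u m] j|H].
  by rewrite ltnS leq_eqVlt => /predU1P[->|/u].
by split; [apply/IH => j jk; apply: H; exact: ltnW|exact: (H k)].
Qed.

Lemma unmatched2P w k h :
  reflect (forall j, (j < k)%N -> ~~ matched w j (h * gen_a ^- j))
    ((unmatched w k).2 h).
Proof.
elim: k => [|k IH] /=; first by left.
apply: (iffP andP) => [[/IH u m] j|H].
  by rewrite ltnS leq_eqVlt => /predU1P[->|/u].
by split; [apply/IH => j jk; apply: H; exact: ltnW|exact: (H k)].
Qed.

Lemma matched_inj1 w g j k : matched w j g -> matched w k g -> j = k.
Proof.
wlog jk : j k / (j < k)%N => [wl mj mk|mj /and3P[/unmatched1P/(_ j jk)]].
  by case: (ltngtP j k) => // jk; [exact: wl|apply/esym/wl].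
by rewrite mj.
Qed.

Lemma matched_inj2 w h j k :
  matched w j (h * gen_a ^- j) -> matched w k (h * gen_a ^- k) -> j = k.
Proof.
wlog jk : j k / (j < k)%N => [wl mj mk|mj /and3P[_ /unmatched2P/(_ j jk)]].
  by case: (ltngtP j k) => // jk; [exact: wl|apply/esym/wl].
by rewrite mulgVK mj.
Qed.

Definition free_end w g := forall k, ~~ matched w k g.
Definition free_slot w h := forall k, ~~ matched w k (h * gen_a ^- k).

(** Otherwise stage [n] would have matched this end with this slot. *)
Lemma free_clash w g n : free_end w g -> free_slot w (g * gen_a ^+ n) ->
  (w g).2 <> (w (g * gen_a ^+ n)).1.
Proof.
move=> fg fh e; have /negP[] := fg n; apply/and3P; split; last exact/eqP.
  by apply/unmatched1P => j _; exact: fg.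
by apply/unmatched2P => j _; exact: fh.
Qed.

(** Left translations and the rewiring maps have this property. The matching looks only along cosets
    of [<a>], so it is carried along by every such map. *)
Definition a_equivariant (e : F2 -> F2) := forall g, e (g * gen_a) = e g * gen_a.

Lemma a_equivariantM e g v : a_equivariant e -> in_a v -> e (g * v) = e g * v.
Proof.
move=> ea av; apply: (mulgI (e g)^-1); rewrite mulKg -{2}[v](mulKg g).
apply: (in_a_ind (Q := fun h => (e g)^-1 * e h = g^-1 * h)) av.
- by rewrite !mulVg.
- by move=> h H; rewrite ea !mulgA H.
- move=> h H; have := ea (h * gen_a^-1); rewrite mulgVK => /esym/(canRL (mulgK _)) ->.
  by rewrite !mulgA H.
Qed.

Lemma matched_equivariant e w w' : a_equivariant e -> (forall g, w' g = w (e g)) ->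
  forall k g, matched w' k g = matched w k (e g).
Proof.
move=> ea ww' k g; have e_exp h j := a_equivariantM h ea (in_a_exp j).
have e_expV h j := a_equivariantM h ea (in_a_expV j).
suff [u1 u2] : (forall g, (unmatched w' k).1 g = (unmatched w k).1 (e g)) /\
               (forall g, (unmatched w' k).2 g = (unmatched w k).2 (e g)).
  by rewrite /matched /matches u1 u2 !ww' e_exp.
elim: k => //= k [u1 u2].
by split=> h; rewrite /matches !u1 !u2 !ww' !e_exp ?e_expV.
Qed.

Lemma mul_expV_exp h i k : (i <= k)%N ->
  h * gen_a ^- k * gen_a ^+ i = h * gen_a ^- (k - i).
Proof.
move=> ik; rewrite expgnFr// invgF -mulgA; congr (_ * _).
have : commute (gen_a ^+ i) (gen_a ^- k) by apply/commuteV/commuteX2.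
by move->.
Qed.

Lemma mul_exp_expV h i k : (i <= k)%N ->
  h * gen_a ^+ k * gen_a ^- i = h * gen_a ^+ (k - i).
Proof. by move=> ik; rewrite expgnFr// mulgA. Qed.

(** Up to stage [k] only ends and slots between [g] and [g * gen_a ^+ k] can take either partner
    away, so nothing outside this window matters. Hence the fate of an end depends on labels ahead
    of it and the fate of a slot on labels behind it; the independence in [lonely_end_null] rests on
    this. *)
Lemma matched_local w w' k g :
  (forall i, (i <= k)%N -> w (g * gen_a ^+ i) = w' (g * gen_a ^+ i)) ->
  matched w k g = matched w' k g.
Proof.
have step j : (forall g, (forall i, (i < j)%N -> w (g * gen_a ^+ i) = w' (g * gen_a ^+ i)) ->
      (unmatched w j).1 g = (unmatched w' j).1 g) ->
    (forall h, (forall i, (i < j)%N -> w (h * gen_a ^- i) = w' (h * gen_a ^- i)) ->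
      (unmatched w j).2 h = (unmatched w' j).2 h) ->
    forall g, (forall i, (i <= j)%N -> w (g * gen_a ^+ i) = w' (g * gen_a ^+ i)) ->
    matched w j g = matched w' j g.
  move=> u1 u2 h wh; rewrite /matched /matches u1; last by move=> i /ltnW; exact: wh.
  rewrite u2; last by move=> i /ltnW ij; rewrite mul_exp_expV// wh// leq_subr.
  by rewrite wh// -[h]mulg1 -(expg0 gen_a) wh.
suff [u1 u2] : (forall g, (forall i, (i < k)%N -> w (g * gen_a ^+ i) = w' (g * gen_a ^+ i)) ->
      (unmatched w k).1 g = (unmatched w' k).1 g) /\
    (forall h, (forall i, (i < k)%N -> w (h * gen_a ^- i) = w' (h * gen_a ^- i)) ->
      (unmatched w k).2 h = (unmatched w' k).2 h) by exact: step.
elim: k {g} => //= k [u1 u2]; split=> h wh; congr (_ && ~~ _).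
- by apply: u1 => i /ltnW; exact: wh.
- by apply: step.
- by apply: u2 => i /ltnW; exact: wh.
- by apply: step => // i ik; rewrite mul_expV_exp// wh// ltnS leq_subr.
Qed.

Lemma matched_line w w' g : (forall v, in_a v -> w (g * v) = w' (g * v)) ->
  forall k v, in_a v -> matched w k (g * v) = matched w' k (g * v).
Proof.
move=> ww' k v av; apply: matched_local => i _.
by rewrite -mulgA ww'// in_aM// in_a_exp.
Qed.

(* On unmatched positions [end_slot] and [slot_end] are the identity. *)
Definition end_slot w g := g * gen_a ^+ xget 0%N [set k | matched w k g].
Definition slot_end w h :=
  h * gen_a ^- xget 0%N [set k | matched w k (h * gen_a ^- k)].

Definition perfect w :=
  forall g, (exists k, matched w k g) /\ (exists k, matched w k (g * gen_a ^- k)).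

Lemma end_slotE w k g : matched w k g -> end_slot w g = g * gen_a ^+ k.
Proof.
move=> m; congr (_ * _ ^+ _).
by apply: (@matched_inj1 w g) => //; apply: (@xgetI _ 0%N [set k | matched w k g] k m).
Qed.

Lemma slot_endE w k h : matched w k (h * gen_a ^- k) -> slot_end w h = h * gen_a ^- k.
Proof.
move=> m; congr (_ * _ ^- _); apply: (@matched_inj2 w h) => //.
by apply: (@xgetI _ 0%N [set k | matched w k (h * gen_a ^- k)] k m).
Qed.

Lemma end_slotK w : perfect w -> cancel (end_slot w) (slot_end w).
Proof.
move=> pw g; have [[k m] _] := pw g.
by rewrite (end_slotE m) (@slot_endE _ k) mulgK.
Qed.

Lemma slot_endK w : perfect w -> cancel (slot_end w) (end_slot w).
Proof.
move=> pw h; have [_ [k m]] := pw h.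
by rewrite (slot_endE m) (end_slotE m) mulgVK.
Qed.

Lemma end_slot_label w g : perfect w -> (w (end_slot w g)).1 = (w g).2.
Proof.
by move=> pw; have [[k m] _] := pw g; rewrite (end_slotE m); case/and3P: m => _ _ /eqP.
Qed.

Lemma end_slot_in_a w g : exists2 v, in_a v & end_slot w g = g * v.
Proof. by eexists; [|reflexivity]; exact: in_a_exp. Qed.

Lemma slot_end_in_a w g : exists2 v, in_a v & slot_end w g = g * v.
Proof. by eexists; [|reflexivity]; exact: in_a_expV. Qed.

Section equivariance.
Context (e : F2 -> F2) (w w' : F2 -> K * K).
Hypotheses (ea : a_equivariant e) (ww' : forall g, w' g = w (e g)).

Lemma end_slot_equivariant g : e (end_slot w' g) = end_slot w (e g).
Proof.
rewrite /end_slot a_equivariantM ?in_a_exp//.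
by under eq_set do rewrite (matched_equivariant ea ww').
Qed.

Lemma slot_end_equivariant g : e (slot_end w' g) = slot_end w (e g).
Proof.
rewrite /slot_end a_equivariantM ?in_a_expV//.
by under eq_set do rewrite (matched_equivariant ea ww') (a_equivariantM _ ea (in_a_expV _)).
Qed.

Lemma perfect_equivariant : perfect w -> perfect w'.
Proof.
move=> pw g; have [[k m] [k' m']] := pw (e g).
split; [exists k|exists k']; rewrite (matched_equivariant ea ww')//.
by rewrite (a_equivariantM _ ea (in_a_expV _)).
Qed.

End equivariance.

Lemma end_slot_line w w' g : (forall v, in_a v -> w (g * v) = w' (g * v)) ->
  end_slot w g = end_slot w' g.
Proof.
move=> ww'; rewrite /end_slot; congr (_ * _ ^+ xget _ _); apply/eq_set => k.
by rewrite -[g]mulg1 (matched_line ww').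
Qed.

Lemma slot_end_line w w' g : (forall v, in_a v -> w (g * v) = w' (g * v)) ->
  slot_end w g = slot_end w' g.
Proof.
move=> ww'; rewrite /slot_end; congr (_ * _ ^- xget _ _); apply/eq_set => k.
by rewrite (matched_line ww')// in_a_expV.
Qed.

End matching.

(** * Rewiring the edges labelled b *)

Section walk.
Local Open Scope group_scope.
Implicit Types (f : F2 -> F2) (g h p : F2).

Definition step f f' p (l : letter) : F2 :=
  if l.1 then if l.2 then f' p else f p
  else if l.2 then p * gen_a^-1 else p * gen_a.

(* The orbit map of the action of F_2 in which a acts by right multiplication
   by a and b acts by f, with inverse f'. *)
Definition walk f f' p g : F2 := foldl (step f f') p (word g).

Section walk_cancel.
Context (f f' : F2 -> F2).
Hypotheses (fK : cancel f f') (f'K : cancel f' f).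

Lemma step_linv p l : step f f' (step f f' p l) (linv l) = p.
Proof.
by case: l => [[] []]; rewrite /step /= ?f'K ?fK ?mulgVK ?mulgK.
Qed.

(** Letters that cancel in the product of two words are harmless because [f] and [f'] undo each
    other. *)
Lemma walkM p g h : walk f f' p (g * h) = walk f f' (walk f f' p g) h.
Proof.
rewrite /walk word_mul; elim: (word g) p => //= l w IH p; rewrite -IH.
case: (foldr _ _ _) => //= l' w'; case: ifP => // /eqP -> /=.
by rewrite step_linv.
Qed.

Lemma walk_letter p g l : walk f f' p (g * letter_elt l) = step f f' (walk f f' p g) l.
Proof. by rewrite walkM. Qed.

Lemma walk_a p : a_equivariant (walk f f' p).
Proof. by move=> g; rewrite walkM. Qed.

Lemma walk_b p g : walk f f' p (g * gen_b) = f (walk f f' p g).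
Proof. by rewrite walkM. Qed.

Lemma walk_bV p g : walk f f' p (g * gen_b^-1) = f' (walk f f' p g).
Proof. by rewrite walkM. Qed.

(** This is how an orbit map gets inverted: a map that turns [f] into right multiplication by
    [gen_b] straightens the walk. It serves for both composites of [rewire] and [unrewire]. *)
Lemma walk_mulg e p g : a_equivariant e -> (forall q, e (f q) = e q * gen_b) ->
  e (walk f f' p g) = e p * g.
Proof.
move=> ea ef; elim/F2_ind_right: g => [|g l _ IH]; first by rewrite mulg1.
rewrite walk_letter mulgA -IH letter_eltE /step; case: l => [[] []] /=.
- by rewrite -{2}[walk _ _ _ _]f'K ef mulgK.
- exact: ef.
- by rewrite (a_equivariantM _ ea in_a_genV).
- exact: ea.
Qed.

End walk_cancel.

Lemma walk_conj e f f' k k' p g : a_equivariant e ->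
  (forall q, e (f q) = k (e q)) -> (forall q, e (f' q) = k' (e q)) ->
  e (walk f f' p g) = walk k k' (e p) g.
Proof.
move=> ea ef ef'; rewrite /walk; elim: (word g) p => //= l w IH p; rewrite IH.
congr (foldl _ _ _); rewrite /step; case: l => [[] []] /=.
- exact: ef'.
- exact: ef.
- by rewrite (a_equivariantM _ ea in_a_genV).
- exact: ea.
Qed.

End walk.

Section rewiring.
Local Open Scope group_scope.
Context (K : eqType).
Implicit Types (z : F2 -> K) (w : F2 -> K * K) (g h p : F2).

(* The open end at g is that of the b-edge arriving from g b^-1. *)
Definition edge_labels z g : K * K := (z g, z (g * gen_b^-1)).

(** The edge leaving [p] has its open end at [p * gen_b], labelled [z p]. The matched slot carries
    the same label, so [z] is constant along the new [b]-edges. *)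
Definition next_b z p := end_slot (edge_labels z) (p * gen_b).
Definition prev_b z p := slot_end (edge_labels z) p * gen_b^-1.
Definition rewire z := walk (next_b z) (prev_b z) 1.
Definition relabel z g := edge_labels z (rewire z g).

(** In the new coordinates [p * gen_b] is the slot to which the edge from [p] was moved; the end
    matched with this slot is where the old edge arrived. *)
Definition unnext w p := slot_end w (p * gen_b).
Definition unprev w p := end_slot w p * gen_b^-1.
Definition unrewire w := walk (unnext w) (unprev w) 1.
Definition unrelabel w h := (w (unrewire w h)).1.

Definition b_invariant w := forall g, (w (g * gen_b)).1 = (w g).1.

Lemma next_bK z : perfect (edge_labels z) -> cancel (next_b z) (prev_b z).
Proof. by move=> pz p; rewrite /prev_b end_slotK// mulgK. Qed.

Lemma prev_bK z : perfect (edge_labels z) -> cancel (prev_b z) (next_b z).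
Proof. by move=> pz p; rewrite /next_b mulgVK slot_endK. Qed.

Lemma unnextK w : perfect w -> cancel (unnext w) (unprev w).
Proof. by move=> pw p; rewrite /unprev slot_endK// mulgK. Qed.

Lemma unprevK w : perfect w -> cancel (unprev w) (unnext w).
Proof. by move=> pw p; rewrite /unnext mulgVK end_slotK. Qed.

Section of_source.
Context z (pz : perfect (edge_labels z)).

Let nK := next_bK pz.
Let pK := prev_bK pz.

Lemma rewireM g h : rewire z (g * h) = walk (next_b z) (prev_b z) (rewire z g) h.
Proof. exact: walkM. Qed.

Lemma rewire_a : a_equivariant (rewire z).
Proof. exact: walk_a. Qed.

Lemma rewire_b g : rewire z (g * gen_b) = end_slot (edge_labels z) (rewire z g * gen_b).
Proof. exact: walk_b. Qed.

Lemma rewire_bV g : rewire z (g * gen_b^-1) = slot_end (edge_labels z) (rewire z g) * gen_b^-1.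
Proof. exact: walk_bV. Qed.

Lemma perfect_relabel : perfect (relabel z).
Proof. exact: (perfect_equivariant rewire_a (fun=> erefl) pz). Qed.

Lemma b_invariant_relabel : b_invariant (relabel z).
Proof.
by move=> g; rewrite /relabel rewire_b end_slot_label//= mulgK.
Qed.

Lemma unrewireK : cancel (unrewire (relabel z)) (rewire z).
Proof.
move=> h; rewrite -[RHS]mul1g /unrewire; apply: (@walk_mulg _ _ _ _ (rewire z) 1).
- exact/unnextK/perfect_relabel.
- exact/unprevK/perfect_relabel.
- exact: rewire_a.
- move=> q; rewrite /unnext (slot_end_equivariant rewire_a (fun=> erefl)).
  by rewrite rewire_b end_slotK.
Qed.

Lemma unrelabel_relabel : unrelabel (relabel z) = z.
Proof. by apply/funext => h; rewrite /unrelabel {1}/relabel unrewireK. Qed.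

Lemma edge_labels_unrewire g : edge_labels z g = relabel z (unrewire (relabel z) g).
Proof. by rewrite {1}/relabel unrewireK. Qed.

Lemma rewireK : cancel (rewire z) (unrewire (relabel z)).
Proof.
move=> g; have pe := perfect_relabel; have uK := unnextK pe; have upK := unprevK pe.
have ua : a_equivariant (unrewire (relabel z)) by exact: walk_a.
have ub q : unrewire (relabel z) (q * gen_b) =
  slot_end (relabel z) (unrewire (relabel z) q * gen_b) by exact: walk_b.
rewrite -[RHS]mul1g; apply: (@walk_mulg _ _ _ _ (unrewire (relabel z)) 1) => // q.
rewrite /next_b (end_slot_equivariant ua edge_labels_unrewire).
by rewrite ub slot_endK.
Qed.

Lemma rewire_inj : injective (rewire z). Proof. exact: can_inj rewireK. Qed.

End of_source.

Section of_target.
Context w (pw : perfect w) (bw : b_invariant w).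

Let ua : a_equivariant (unrewire w).
Proof. by apply: walk_a; [exact: unnextK|exact: unprevK]. Qed.

Let ub p : unrewire w (p * gen_b) = slot_end w (unrewire w p * gen_b).
Proof. by apply: walk_b; [exact: unnextK|exact: unprevK]. Qed.

(** Here [b]-invariance enters: the end at [unrewire w g] is matched with the slot at
    [unrewire w (g * gen_b^-1) * gen_b], and invariance carries the label of that slot back to
    [unrewire w (g * gen_b^-1)]. *)
Lemma edge_labels_unrelabel g : edge_labels (unrelabel w) g = w (unrewire w g).
Proof.
rewrite [RHS]surjective_pairing; congr (_, _).
rewrite -[g in RHS](mulgVK gen_b) ub -end_slot_label// slot_endK// bw.
Qed.

Lemma perfect_unrelabel : perfect (edge_labels (unrelabel w)).
Proof. exact: perfect_equivariant ua edge_labels_unrelabel pw. Qed.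

Lemma relabel_unrelabel : relabel (unrelabel w) = w.
Proof.
apply/funext => g; rewrite /relabel edge_labels_unrelabel; congr w.
rewrite -[RHS]mul1g; apply: (@walk_mulg _ _ _ _ (unrewire w) 1) => //.
- exact/next_bK/perfect_unrelabel.
- exact/prev_bK/perfect_unrelabel.
- move=> q; rewrite /next_b (end_slot_equivariant ua edge_labels_unrelabel).
  by rewrite ub slot_endK.
Qed.

End of_target.

Lemma perfect_translate w h : perfect w -> perfect (fun f => w (h * f)).
Proof. by apply: (@perfect_equivariant _ ( *%g h)) => // g; rewrite mulgA. Qed.

Lemma edge_labels_translate z h :
  edge_labels (fun f => z (h * f)) = fun f => edge_labels z (h * f).
Proof. by apply/funext => g; rewrite /edge_labels mulgA. Qed.

Lemma rewire_translate z h g :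
  h * rewire (fun f => z (h * f)) g = walk (next_b z) (prev_b z) h g.
Proof.
rewrite /rewire -[h in RHS]mulg1.
have ha : a_equivariant ( *%g h) by move=> q; rewrite mulgA.
have E q : edge_labels (fun f => z (h * f)) q = edge_labels z (h * q).
  by rewrite edge_labels_translate.
apply: (walk_conj (e := ( *%g h))) => // q.
  by rewrite /next_b (end_slot_equivariant ha E) mulgA.
by rewrite /prev_b mulgA (slot_end_equivariant ha E).
Qed.

Lemma rewire_translate_rewire z u g : perfect (edge_labels z) ->
  rewire z u * rewire (fun f => z (rewire z u * f)) g = rewire z (u * g).
Proof. by move=> pz; rewrite rewire_translate rewireM. Qed.

(** The cocycle identity: moving the root to [rewire z u] shifts the relabelling by [u]. Both the
    equality of orbits and the shift invariance of the law come from it. *)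
Lemma relabel_translate z u : perfect (edge_labels z) ->
  relabel (fun f => z (rewire z u * f)) = fun g => relabel z (u * g).
Proof.
move=> pz; apply/funext => g; rewrite /relabel edge_labels_translate.
by rewrite rewire_translate_rewire.
Qed.

(** ** Locality *)

Lemma half_b_in_a g v : in_a v -> half_b (g * v) = half_b g.
Proof.
apply: (in_a_ind (Q := fun h => half_b h = half_b g)) => // h.
  by rewrite half_b_mula.
by rewrite half_b_mulaV.
Qed.

Lemma edge_labels_half z z' (P : pred F2) g :
  (forall f, P f -> z f = z' f) -> (forall v, in_a v -> P (g * v)) ->
  (forall v, in_a v -> P (g * v * gen_b^-1)) ->
  forall v, in_a v -> edge_labels z (g * v) = edge_labels z' (g * v).
Proof. by move=> zz' P1 P2 v av; rewrite /edge_labels !zz' ?P1 ?P2. Qed.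

(** A coset of [<a>] lies on one side, and a moved edge keeps the coset in which it arrives, so the
    edge leaving 1 is still the only one that crosses. *)
Lemma rewire_half_bN z z' : perfect (edge_labels z) ->
  perfect (edge_labels z') -> (forall f, ~~ half_b f -> z f = z' f) ->
  forall g, ~~ half_b g ->
    ~~ half_b (rewire z g) /\ rewire z g = rewire z' g.
Proof.
move=> pz pz' zz'; elim/F2_ind_right => [|g l]; first by [].
have line p : ~~ half_b p -> forall v, in_a v ->
    edge_labels z (p * v) = edge_labels z' (p * v).
  move=> hp; apply: (edge_labels_half (P := fun f => ~~ half_b f)) => // v av.
    by rewrite half_b_in_a.
  rewrite -(half_b_in_a _ av) half_b_mulbV negb_or in hp.
  by case/andP: hp.
rewrite letter_eltE; case: l => [[] []] /= gl1 IH hgl.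
- have hg : ~~ half_b g.
    rewrite half_b_mulbV negb_or hgl /=.
    by apply: contra gl1 => /eqP ->; rewrite mulgV.
  have [hp e] := IH hg; rewrite !rewire_bV// -e -(slot_end_line (line _ hp)).
  split=> //; have [v av ->] := slot_end_in_a (edge_labels z) (rewire z g).
  by move: hp; rewrite -(half_b_in_a _ av) half_b_mulbV negb_or => /andP[].
- have [hg g1] : ~~ half_b g /\ g != 1.
    by apply/andP; rewrite -negb_or -half_b_mulb.
  have [hp e] := IH hg.
  have hpb : ~~ half_b (rewire z g * gen_b).
    rewrite half_b_mulb negb_or hp /=; apply: contra g1 => /eqP p1.
    by apply/eqP/(rewire_inj pz).
  rewrite !rewire_b// -e -(end_slot_line (line _ hpb)); split => //.
  by have [v av ->] := end_slot_in_a (edge_labels z) (rewire z g * gen_b);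
    rewrite half_b_in_a.
- rewrite half_b_mulaV in hgl; have [hp e] := IH hgl.
  rewrite !a_equivariantM ?in_a_genV//; try exact: rewire_a.
  by rewrite half_b_mulaV -e.
- rewrite half_b_mula in hgl; have [hp e] := IH hgl.
  by rewrite !rewire_a// half_b_mula -e.
Qed.

Lemma relabel_half_bN z z' : perfect (edge_labels z) -> perfect (edge_labels z') ->
  (forall f, ~~ half_b f -> z f = z' f) ->
  forall g, ~~ half_b g -> relabel z g = relabel z' g.
Proof.
move=> pz pz' zz' g hg; have [hp e] := rewire_half_bN pz pz' zz' hg.
rewrite /relabel -e /edge_labels !zz'//.
by move: hp; rewrite half_b_mulbV negb_or => /andP[].
Qed.

(** The vertex 1 is included among the known labels because the open end at [gen_b] carries its
    label. *)
Lemma rewire_half_b z z' : perfect (edge_labels z) -> perfect (edge_labels z') ->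
  (forall f, half_b f || (f == 1) -> z f = z' f) ->
  forall g, half_b g -> half_b (rewire z g) /\ rewire z g = rewire z' g.
Proof.
move=> pz pz' zz'.
have line p : half_b p -> forall v, in_a v ->
    edge_labels z (p * v) = edge_labels z' (p * v).
  move=> hp; apply: (edge_labels_half (P := fun f => half_b f || (f == 1))) => // v av.
    by rewrite half_b_in_a// hp.
  by rewrite -(half_b_in_a _ av) half_b_mulbV in hp; rewrite mulg_eq1 invgK.
have half1 g : half_b g -> half_b (rewire z g) || (rewire z g == 1) ->
    half_b (rewire z g).
  move=> hg /orP[//|/eqP p1]; move: hg.
  by rewrite (_ : g = 1)//; exact/(rewire_inj pz).
(* The walk starts at 1, outside the far side, so the induction has to admit this vertex. *)
suff H g : half_b g || (g == 1) ->
    (half_b (rewire z g) || (rewire z g == 1)) /\ rewire z g = rewire z' g.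
  move=> g hg; have [|hp e] := H g; first by rewrite hg.
  by split; first exact: half1.
elim/F2_ind_right: g => [|g l]; first by rewrite eqxx orbT.
move=> gl1 IH; rewrite (negPf gl1) orbF; move: gl1; rewrite letter_eltE.
case: l => [[] []] /= gl1 hgl.
- have hg : half_b g by rewrite half_b_mulbV hgl.
  have [|hp e] := IH; first by rewrite hg.
  have {}hp := half1 _ hg hp.
  rewrite !rewire_bV// -e -(slot_end_line (line _ hp)); split=> //.
  have [v av ->] := slot_end_in_a (edge_labels z) (rewire z g).
  by rewrite mulg_eq1 invgK -half_b_mulbV half_b_in_a.
- have [|hp e] := IH; first by rewrite -half_b_mulb.
  rewrite -half_b_mulb in hp.
  rewrite !rewire_b// -e -(end_slot_line (line _ hp)); split=> //.
  have [v av ->] := end_slot_in_a (edge_labels z) (rewire z g * gen_b).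
  by rewrite half_b_in_a// hp.
- rewrite half_b_mulaV in hgl; have [|/(half1 _ hgl) hp e] := IH; first by rewrite hgl.
  rewrite !a_equivariantM ?in_a_genV//; try exact: rewire_a.
  by rewrite half_b_mulaV hp -e.
- rewrite half_b_mula in hgl; have [|/(half1 _ hgl) hp e] := IH; first by rewrite hgl.
  by rewrite !rewire_a// half_b_mula hp -e.
Qed.

Lemma relabel_half_b z z' : perfect (edge_labels z) -> perfect (edge_labels z') ->
  (forall f, half_b f || (f == 1) -> z f = z' f) ->
  forall g, half_b g -> relabel z g = relabel z' g.
Proof.
move=> pz pz' zz' g hg; have [hp e] := rewire_half_b pz pz' zz' hg.
rewrite /relabel -e /edge_labels !zz' ?hp//.
by move: hp; rewrite half_b_mulbV mulg_eq1 invgK.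
Qed.

End rewiring.

(** * Measures *)

Section measure_facts.
Context d (X : measurableType d) (R : realType).
Implicit Types mu : probability X R.

Lemma measurable_preim d' (Y : measurableType d') (f : X -> Y) B :
  measurable_fun setT f -> measurable B -> measurable (f @^-1` B).
Proof. by move=> mf mB; rewrite -[_ @^-1` _]setTI; exact: mf. Qed.

(** Split over the countably many values of [f]; random vertices and labels are handled in this way
    throughout. *)
Lemma measurable_at (T : Type) (f : X -> T) (P : T -> set X) :
  countable [set: T] -> (forall t, measurable [set x | f x = t]) ->
  (forall t, measurable (P t)) -> measurable [set x | P (f x) x].
Proof.
move=> cT mf mP.
rewrite (_ : [set x | _] = \bigcup_t ([set x | f x = t] `&` P t)).
  by apply: countable_bigcupT_measurable => // t; exact: measurableI.
apply/seteqP; split=> [x Px|x [t _ [/= ->]]//].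
by exists (f x).
Qed.

Lemma measure_eq_on mu A B N : measurable A -> measurable B -> measurable N ->
  mu (~` N) = 0%E -> (forall x, N x -> A x <-> B x) -> mu A = mu B.
Proof.
move=> mA mB mN N0 AB.
have null C : measurable C -> mu C = mu (C `&` N).
  move=> mC; rewrite [LHS](measureDI mu mC mN) [X in (X + _)%E](_ : _ = 0%E) ?add0e//.
  have mN' := measurableC mN; have mD := measurableD mC mN.
  by apply: (subset_measure0 mD mN') => // x [].
rewrite (null A)// (null B)//; congr (mu _).
by apply/seteqP; split=> x [/= H Nx]; split=> //; apply/AB.
Qed.

Lemma measure0I mu A B : measurable A -> measurable B ->
  mu (~` A) = 0%E -> mu (~` B) = 0%E -> mu (~` (A `&` B)) = 0%E.
Proof. by move=> mA mB A0 B0; rewrite setCI measureU0//; exact: measurableC. Qed.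

Lemma measure0_bigcup (T : Type) mu (F : T -> set X) : countable [set: T] ->
  (forall t, measurable (F t)) -> (forall t, mu (F t) = 0%E) ->
  mu (\bigcup_t F t) = 0%E.
Proof.
move=> cT mF F0; apply/negligibleP; first exact: countable_bigcupT_measurable.
have {}F0 t : mu.-negligible (F t) by apply/(negligibleP mu (mF t))/F0.
elim/Ppointed: T => T in F cT mF F0 *.
  by rewrite empty_eq0 bigcup0//; exact: negligible_set0.
move/countable_bijP: cT => [B] /ppcard_eqP[f].
rewrite (reindex_bigcup f^-1%FUN setT)//=; first exact: negligible_bigcup.
exact: (@subl_surj _ _ B).
Qed.

(** The first [n] members have total mass [n] times [c], which stays below 1 for all [n] only if [c]
    vanishes. This excludes a uniformly distributed position on the integers. *)
Lemma trivIset_const_measure0 mu (F : nat -> set X) c :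
  (forall n, measurable (F n)) -> trivIset setT F ->
  (forall n, mu (F n) = c) -> c = 0%E.
Proof.
move=> mF tF Fc.
have cfin : c \is a fin_num by rewrite -(Fc 0%N) fin_num_measure.
have c0 : (0 <= c)%E by rewrite -(Fc 0%N).
rewrite -(fineK cfin) in c0 Fc *; set r := fine c in c0 Fc *.
rewrite lee_fin in c0; congr (_%:E); apply/eqP/negPn/negP => rn0.
have r0 : (0 < r)%R by rewrite lt0r rn0.
have H n : (n%:R * r <= 1)%R.
  rewrite -lee_fin; have <- : mu (\big[setU/set0]_(i < n) F i) = (n%:R * r)%:E.
    rewrite measure_bigsetU//.
    rewrite (eq_bigr (fun=> r%:E)) => [|i _]; last exact: Fc.
    rewrite sumEFin sumr_const card_ord.
    by rewrite mulr_natl.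
  by apply: probability_le1; exact: bigsetU_measurable.
have := H (Num.bound r^-1); rewrite leNgt => /negP; apply.
by rewrite -ltr_pdivrMr// div1r archi_boundP// invr_ge0.
Qed.

End measure_facts.

(** The tool for mass transport: maps that act by a translation depending on the piece are compared
    piece by piece. The index type is injected into [nat]; numbers outside the range contribute
    empty pieces. *)
Lemma measure_partition_eq (R : realType) d (X : measurableType d)
    (mu : probability X R) d' (Y : measurableType d') (nu : probability Y R)
    (T : Type) (f : X -> T) (g : Y -> T) A B :
  countable [set: T] -> (forall t, measurable [set x | f x = t]) ->
  (forall t, measurable [set y | g y = t]) -> measurable A -> measurable B ->
  (forall t, mu (A `&` [set x | f x = t]) = nu (B `&` [set y | g y = t])) ->
  mu A = nu B.
Proof.
move=> /countable_injP[j /in2TT j_inj] mf mg mA mB AB.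
have pieces d0 (Z : measurableType d0) (m : probability Z R) (h : Z -> T) C :
    (forall t, measurable [set x | h x = t]) -> measurable C ->
    (forall n, measurable (C `&` [set x | j (h x) = n])) /\
    m C = (\sum_(n <oo) m (C `&` [set x | j (h x) = n]))%E.
  move=> mh mC; have mn n : measurable (C `&` [set x | j (h x) = n]).
    apply: measurableI => //; have [[t jt]|nt] := pselect (exists t, j t = n).
      rewrite (_ : [set _ | _] = [set x | h x = t])//.
      by apply/seteqP; split=> x /=; [rewrite -jt => /j_inj|move=> ->].
    rewrite (_ : [set _ | _] = set0)//; apply/seteqP; split=> // x /= jx.
    by apply: nt; exists (h x).
  split=> //; rewrite [LHS](_ : _ = m (\bigcup_n (C `&` [set x | j (h x) = n]))).
    rewrite measure_bigcup//; first by apply: eq_eseriesl => n; rewrite in_setT.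
    by move=> n p _ _ [x [[_ /= <-] [_ /= <-]]].
  congr (m _); apply/seteqP; split=> [x Cx|x [n _ []]//].
  by exists (j (h x)).
have [_ ->] := pieces _ _ mu f A mf mA; have [_ ->] := pieces _ _ nu g B mg mB.
apply: eq_eseriesr => n _; have [[t jt]|nt] := pselect (exists t, j t = n).
  have E (Z : Type) (h : Z -> T) : [set x | j (h x) = n] = [set x | h x = t].
    by apply/seteqP; split=> x /=; [rewrite -jt => /j_inj|move=> ->].
  by rewrite !E.
have E (Z : Type) (h : Z -> T) : [set x | j (h x) = n] = set0.
  by apply/seteqP; split=> // x /= jx; apply: nt; exists (h x).
by rewrite !E !setI0 !measure0.
Qed.

(** * Product measures: change of index set and exchange of coordinates *)

Section product_probability.
Context d (K : countableDiscreteType d) (R : realType) (kappa : probability K R).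
Notation mu I := (product_probability I kappa).

Section pullback.
Context (I J : countType) (e : I -> J).

Definition pullback (x : prod_space J K) : prod_space I K := fun i => x (e i).

Lemma measurable_pullback : measurable_fun setT pullback.
Proof.
apply: measurable_fun_prod_space => i _ B mB; rewrite setTI.
exact: measurable_coord.
Qed.
HB.instance Definition _ := isMeasurableFun.Build _ _ _ _ pullback measurable_pullback.

Lemma product_probability_pullback A : injective e -> measurable A ->
  mu J (pullback @^-1` A) = mu I A.
Proof.
move=> e_inj mA; apply: (is_product_unique (kappa := kappa)
  (mu := distribution (mu J) pullback)) => //; last exact: product_probabilityP.
move=> s B us mB.
pose C j := [set k | forall i, i \in s -> e i = j -> B i k].
have CB i : i \in s -> C (e i) = B i.
  move=> si; apply/seteqP; split => k; first exact.
  by move=> Bk i' _ /e_inj ->.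
transitivity (\prod_(j <- map e s) kappa (C j))%E; last first.
  by rewrite big_map big_seq [RHS]big_seq; apply: eq_bigr => i /CB ->.
rewrite -(product_probabilityP kappa (s := map e s) (A := C)); last 2 first.
- by rewrite map_inj_uniq.
- by move=> j; exact: discrete_measurableE.
rewrite -[LHS]/(mu J (pullback @^-1` [set x | forall i, i \in s -> B i (x i)])).
congr (mu J _); apply/seteqP; split => x /= H.
  by move=> _ /mapP[i si ->] i' si' /e_inj <-; exact: H.
by move=> i si; rewrite -CB//; apply: H; exact: map_f.
Qed.

End pullback.

Lemma product_probability1 (I : countType) (i : I) (B : set K) :
  mu I [set x | B (x i)] = kappa B.
Proof.
transitivity (\prod_(j <- [:: i]) kappa B)%E; last by rewrite big_cons big_nil mule1.
rewrite -(@product_probabilityP I _ K R kappa [:: i] (fun=> B))//; last first.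
  by move=> _; exact: discrete_measurableE.
congr (mu I _); apply/seteqP; split=> x /=; last by apply; rewrite inE.
by move=> Bx j; rewrite inE => /eqP ->.
Qed.

Section disjoint_sum.
Context (I J : countType).

Definition merge (xy : prod_space I K * prod_space J K) : prod_space (I + J)%type K :=
  fun s => match s with inl i => xy.1 i | inr j => xy.2 j end.

Lemma measurable_merge : measurable_fun setT merge.
Proof.
apply: measurable_fun_prod_space => -[i|j].
  apply: (measurableT_comp (f := fun x : prod_space I K => x i)) => //.
  by move=> _ B mB; rewrite setTI; exact: measurable_coord.
apply: (measurableT_comp (f := fun x : prod_space J K => x j)) => //.
by move=> _ B mB; rewrite setTI; exact: measurable_coord.
Qed.
HB.instance Definition _ := isMeasurableFun.Build _ _ _ _ merge measurable_merge.

Let prod_IJ : probability (prod_space I K * prod_space J K)%type R := (mu I \x mu J)%E.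

Let measurable_box (T : countType) (s : seq T) (A : T -> set K) :
  measurable ([set x | forall i, i \in s -> A i (x i)] : set (prod_space T K)).
Proof.
rewrite (_ : [set _ | _] = \bigcap_i [set x | i \in s -> A i (x i)]); last first.
  by apply/seteqP; split=> [x H i _|x H i]; [exact: H|exact: (H i Logic.I)].
rewrite -[X in measurable X]setCK setC_bigcap; apply: measurableC.
apply: countable_bigcupT_measurable => [|i]; [exact: countableP|apply: measurableC].
case: (i \in s) => //; last by rewrite (_ : [set _ | _] = setT)//; apply/seteqP; split.
rewrite (_ : [set _ | _] = [set x | A i (x i)]); last first.
  by apply/seteqP; split=> x /=; [exact|].
by apply: measurable_coord; exact: discrete_measurableE.
Qed.

Lemma is_product_merge : is_product kappa (distribution prod_IJ merge).
Proof.
move=> s A us mA.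
pose inls := pmap (fun u : I + J => if u is inl i then Some i else None) s.
pose inrs := pmap (fun u : I + J => if u is inr j then Some j else None) s.
have inlsE i : (i \in inls) = (inl i \in s).
  rewrite mem_pmap; apply/mapP/idP => [[[i'|//] si' [->]]//|si].
  by exists (inl i).
have inrsE j : (j \in inrs) = (inr j \in s).
  rewrite mem_pmap; apply/mapP/idP => [[[//|j'] sj' [->]]//|sj].
  by exists (inr j).
have uinls : uniq inls by apply: (pmap_uniq (g := inl)) us => -[].
have uinrs : uniq inrs by apply: (pmap_uniq (g := inr)) us => -[].
have perm : perm_eq s (map inl inls ++ map inr inrs).
  apply: uniq_perm => //.
    rewrite cat_uniq !map_inj_uniq ?uinls ?uinrs//=; try by move=> ? ? [].
    by rewrite andbT; apply/hasPn => _ /mapP[j _ ->]; apply/negP => /mapP[].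
  move=> [i|j]; rewrite mem_cat.
    rewrite mem_map ?inlsE; last by move=> ? ? [].
    by case: (inl i \in s) => //=; apply/esym/negP => /mapP[].
  rewrite [in X in _ || X]mem_map ?inrsE; last by move=> ? ? [].
  by case: (inr j \in s); rewrite ?orbT ?orbF//; apply/esym/negP => /mapP[].
rewrite (perm_big _ perm) big_cat !big_map /=.
rewrite -(@product_probabilityP I _ K R kappa inls (A \o inl))//; last by move=> i; exact: mA.
rewrite -(@product_probabilityP J _ K R kappa inrs (A \o inr))//; last by move=> j; exact: mA.
rewrite -product_measure1E//; try exact: measurable_box.
congr (prod_IJ _); apply/seteqP; split=> -[x y] /= H.
  by split=> [i|j]; rewrite ?inlsE ?inrsE => /H.
by case: H => Hx Hy [i|j]; rewrite -?inlsE -?inrsE; [exact: Hx|exact: Hy].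
Qed.

Lemma product_probability_merge A : measurable A ->
  mu (I + J)%type A = (mu I \x mu J)%E (merge @^-1` A).
Proof.
move=> mA; rewrite (is_product_unique (product_probabilityP kappa) is_product_merge)//.
Qed.

Lemma product_probability_inlr A B : measurable A -> measurable B ->
  mu (I + J)%type (pullback inl @^-1` A `&` pullback inr @^-1` B) = (mu I A * mu J B)%E.
Proof.
move=> mA mB; rewrite product_probability_merge; last first.
  by apply: measurableI; apply: measurable_preim => //; exact: measurable_pullback.
by rewrite -product_measure1E.
Qed.

End disjoint_sum.

Section exchange.
Context (I : countType) (P : pred I).

Definition mix (x y : prod_space I K) : prod_space I K :=
  fun i => if P i then x i else y i.

Let swap (s : I + I) : I + I :=
  match s with
  | inl i => if P i then inl i else inr i
  | inr i => if P i then inr i else inl i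
  end.

Let swapK : involutive swap.
Proof. by case=> i /=; case: ifP => /= ->. Qed.

(* Exchanging the coordinates outside P of two independent samples preserves
   their joint law. *)
Lemma mix_eq (X A B C D : set (prod_space I K)) :
  measurable X -> mu I (~` X) = 0%E ->
  measurable A -> measurable B -> measurable C -> measurable D ->
  (forall x y, X x -> X y -> X (mix x y) -> X (mix y x) ->
    A x /\ B y <-> C (mix x y) /\ D (mix y x)) ->
  (mu I A * mu I B = mu I C * mu I D)%E.
Proof.
move=> mX X0 mA mB mC mD H.
have mpl (E : set (prod_space I K)) :
    measurable E -> measurable (pullback (inl : I -> I + I) @^-1` E).
  by move=> mE; apply: measurable_preim => //; exact: measurable_pullback.
have mpr (E : set (prod_space I K)) :
    measurable E -> measurable (pullback (inr : I -> I + I) @^-1` E).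
  by move=> mE; apply: measurable_preim => //; exact: measurable_pullback.
have mps (E : set (prod_space (I + I)%type K)) :
    measurable E -> measurable (pullback swap @^-1` E).
  by move=> mE; apply: measurable_preim => //; exact: measurable_pullback.
have swap_inj := inv_inj swapK.
rewrite -!product_probability_inlr//.
rewrite -[RHS](product_probability_pullback swap_inj); last first.
  by apply: measurableI; [exact: mpl|exact: mpr].
pose XX := pullback (inl : I -> I + I) @^-1` X `&` pullback (inr : I -> I + I) @^-1` X.
have mXX : measurable XX by apply: measurableI; [exact: mpl|exact: mpr].
have XX0 : mu (I + I)%type (~` XX) = 0%E.
  apply: measure0I; [exact: mpl|exact: mpr| |]; rewrite preimage_setC.
    by rewrite (product_probability_pullback (@inl_inj I I) (measurableC mX)).
  by rewrite (product_probability_pullback (@inr_inj I I) (measurableC mX)).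
apply: (measure_eq_on (N := XX `&` pullback swap @^-1` XX)).
- by apply: measurableI; [exact: mpl|exact: mpr].
- by apply: mps; apply: measurableI; [exact: mpl|exact: mpr].
- by apply: measurableI => //; exact: mps.
- apply: measure0I => //; first exact: mps.
  by rewrite preimage_setC (product_probability_pullback swap_inj (measurableC mXX)).
have mixl w : pullback inl (pullback swap w) = mix (pullback inl w) (pullback inr w).
  by apply/funext => i; rewrite /pullback /mix /=; case: ifP.
have mixr w : pullback inr (pullback swap w) = mix (pullback inr w) (pullback inl w).
  by apply/funext => i; rewrite /pullback /mix /=; case: ifP.
by move=> w [[Xl Xr] []]; rewrite /= /preimage /= !mixl !mixr => Xm Xm'; exact: H.
Qed.

Lemma product_independence (A B : set (prod_space I K)) : measurable A -> measurable B ->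
  (forall x y, (forall i, P i -> x i = y i) -> A x -> A y) ->
  (forall x y, (forall i, ~~ P i -> x i = y i) -> B x -> B y) ->
  mu I (A `&` B) = (mu I A * mu I B)%E.
Proof.
move=> mA mB HA HB.
(* Independence is the exchange identity in which one of the mixed samples satisfies both events and
   the other none. *)
rewrite -[LHS]mule1 -[1%E](probability_setT (mu I)); apply/esym.
apply: (mix_eq (X := setT)) => //; first by rewrite setCT.
  exact: measurableI.
move=> x y _ _ _ _; split=> [[Ax By]|[[Am Bm] _]]; last split.
- split=> //; split.
    by apply: HA Ax => i Pi; rewrite /mix Pi.
  by apply: HB By => i /negPf Pi; rewrite /mix Pi.
- by apply: HA Am => i Pi; rewrite /mix Pi.
- by apply: HB Bm => i /negPf Pi; rewrite /mix Pi.
Qed.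

(** Exchange the coordinates outside [P] between a sample of [A] and a sample of [B]. Both have the
    value [k] at [c], so [B], which also reads [c], does not notice. The two events need to be local
    only on the conull set [X], since relabelling is local only where the matching is perfect. *)
Lemma product_conditional_independence (X A B : set (prod_space I K)) c k : P c ->
  measurable X -> mu I (~` X) = 0%E -> measurable A -> measurable B ->
  (forall x y, X x -> X y -> (forall i, P i -> x i = y i) -> A x -> A y) ->
  (forall x y, X x -> X y -> (forall i, ~~ P i || (i == c) -> x i = y i) -> B x -> B y) ->
  (mu I (A `&` [set x | x c = k]) * mu I (B `&` [set x | x c = k]) =
   mu I (A `&` B `&` [set x | x c = k]) * kappa [set k])%E.
Proof.
move=> Pc mX X0 mA mB HA HB.
have mk : measurable [set x : prod_space I K | x c = k].
  by apply: (measurable_coord c (B := [set k])); exact: discrete_measurableE.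
rewrite -(product_probability1 c [set k]).
apply: (mix_eq mX X0); do ?[exact: measurableI|exact: mk]; first by apply: measurableI => //; exact: measurableI.
move=> x y Xx Xy Xm Xm'.
have mc : mix x y c = x c by rewrite /mix Pc.
have mc' : mix y x c = y c by rewrite /mix Pc.
rewrite /= mc mc'; split.
- move=> [[Ax xk] [By yk]]; do !split=> //.
    by apply: HA Ax => // i Pi; rewrite /mix Pi.
  apply: HB By => // i /orP[/negPf Pi|/eqP ->]; first by rewrite /mix Pi.
  by rewrite mc xk.
- move=> [[[Am Bm] xk] yk]; do !split=> //.
    by apply: HA Am => // i Pi; rewrite /mix Pi.
  apply: HB Bm => // i /orP[/negPf Pi|/eqP ->]; first by rewrite /mix Pi.
  by rewrite mc xk.
Qed.

End exchange.

End product_probability.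

(** * Measurability of the matching and of the rewiring *)

Section quantifiers.
Context d (X : measurableType d).

Lemma measurable_forall (T : Type) (P : T -> set X) : countable [set: T] ->
  (forall t, measurable (P t)) -> measurable [set x | forall t, P t x].
Proof.
move=> cT mP; rewrite (_ : [set x | _] = \bigcap_t P t); last first.
  by apply/seteqP; split=> [x H t _|x H t]; [exact: H|exact: (H t Logic.I)].
rewrite -[X in measurable X]setCK setC_bigcap; apply: measurableC.
by apply: countable_bigcupT_measurable => // t; exact: measurableC.
Qed.

Lemma measurable_exists (T : Type) (P : T -> set X) : countable [set: T] ->
  (forall t, measurable (P t)) -> measurable [set x | exists t, P t x].
Proof.
move=> cT mP; rewrite (_ : [set x | _] = \bigcup_t P t); last first.
  by apply/seteqP; split=> [x [t ?]|x [t _ ?]]; exists t.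
exact: countable_bigcupT_measurable.
Qed.

Lemma measurable_andb (p q : X -> bool) : measurable [set x | p x] ->
  measurable [set x | q x] -> measurable [set x | p x && q x].
Proof.
move=> mp mq; rewrite (_ : [set x | _] = [set x | p x] `&` [set x | q x]).
  exact: measurableI.
by apply/seteqP; split=> x /=; [move/andP|move=> [-> ->]].
Qed.

Lemma measurable_negb (p : X -> bool) : measurable [set x | p x] ->
  measurable [set x | ~~ p x].
Proof.
move=> mp; rewrite (_ : [set x | _] = ~` [set x | p x]); first exact: measurableC.
by apply/seteqP; split=> x /negP.
Qed.

Lemma measurable_cst_set (P : Prop) : measurable [set x : X | P].
Proof.
have [p|np] := pselect P.
  by rewrite (_ : [set x | _] = setT)//; apply/seteqP; split.
by rewrite (_ : [set x | _] = set0)//; apply/seteqP; split.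
Qed.

Lemma measurable_first (P : nat -> X -> bool) n :
  (forall k, measurable [set x | P k x]) ->
  (forall x j k, P j x -> P k x -> j = k) ->
  measurable [set x | xget 0%N [set k | P k x] = n].
Proof.
(* The default 0 of [xget] puts the samples without any index into the level set of 0. *)
move=> mP P_inj; rewrite (_ : [set x | _] = [set x | P n x] `|`
  ([set x | n = 0%N] `&` [set x | forall k, ~~ P k x])).
  apply: measurableU => //; apply: measurableI; first exact: measurable_cst_set.
  by apply: measurable_forall => // k; exact: measurable_negb.
apply/seteqP; split=> x /=.
  case: xgetP => [_ -> Px <-|nP <-]; first by left.
  by right; split=> // k; apply/negP; exact: nP.
move=> [Pn|[-> nP]].
  by apply: (P_inj x) => //; exact: (@xgetI _ 0%N [set k | P k x] n).
by case: xgetP => // k _ /= Pk; have := nP k; rewrite Pk.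
Qed.

End quantifiers.

Section measurability.
Local Open Scope group_scope.
Context d (K : countableDiscreteType d).
Implicit Types (g h p : F2).
Notation sample := (prod_space F2 K).
Notation pair_sample := (prod_space F2 (K * K)%type).

Lemma countable_F2 : countable [set: F2]. Proof. exact: countableP. Qed.

Lemma countable_nat : countable [set: nat]. Proof. exact: countableP. Qed.

Let measurable_fst_coord g (B : set K) : measurable [set w : pair_sample | B (w g).1].
Proof.
apply: (measurable_coord g (B := [set x : K * K | B x.1])).
by rewrite -[X in measurable X]setTI; apply: measurable_fst => //; exact: discrete_measurableE.
Qed.

Let measurable_snd_coord g (B : set K) : measurable [set w : pair_sample | B (w g).2].
Proof.
apply: (measurable_coord g (B := [set x : K * K | B x.2])).
by rewrite -[X in measurable X]setTI; apply: measurable_snd => //; exact: discrete_measurableE.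
Qed.

Lemma measurable_matched k g : measurable [set w : pair_sample | matched w k g].
Proof.
have step (u : pair_sample -> (F2 -> bool) * (F2 -> bool)) j h :
    (forall g, measurable [set w | (u w).1 g]) ->
    (forall g, measurable [set w | (u w).2 g]) ->
    measurable [set w : pair_sample | matches (u w) w j h].
  move=> u1 u2; apply: measurable_andb => //; apply: measurable_andb => //.
  apply: (measurable_at (f := fun w : pair_sample => (w h).2)
    (P := fun t => [set w : pair_sample | t == (w (h * gen_a ^+ j)).1])).
  - exact: countable_carrier.
  - by move=> t; exact: (measurable_snd_coord h [set t]).
  - by move=> t; exact: (measurable_fst_coord _ [set x | t == x]).
suff [u1 u2] : (forall g, measurable [set w : pair_sample | (unmatched w k).1 g]) /\
    (forall g, measurable [set w : pair_sample | (unmatched w k).2 g]) by exact: step.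
elim: k => [|k [u1 u2]] /=; first by split=> h; exact: measurable_cst_set.
by split=> h; apply: measurable_andb => //; apply: measurable_negb; exact: step.
Qed.

Lemma measurable_end_slot g h : measurable [set w : pair_sample | end_slot w g = h].
Proof.
apply: (measurable_at (P := fun n => [set w : pair_sample | g * gen_a ^+ n = h])).
- exact: countable_nat.
- move=> n; apply: measurable_first; first by move=> k; exact: measurable_matched.
  by move=> w; exact: matched_inj1.
- by move=> n; exact: measurable_cst_set.
Qed.

Lemma measurable_slot_end g h : measurable [set w : pair_sample | slot_end w g = h].
Proof.
apply: (measurable_at (P := fun n => [set w : pair_sample | g * gen_a ^- n = h])).
- exact: countable_nat.
- move=> n; apply: measurable_first; first by move=> k; exact: measurable_matched.
  by move=> w; exact: matched_inj2.
- by move=> n; exact: measurable_cst_set.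
Qed.

Lemma measurable_walk d' (X : measurableType d') (f f' : X -> F2 -> F2) p g h :
  (forall q r, measurable [set x | f x q = r]) ->
  (forall q r, measurable [set x | f' x q = r]) ->
  measurable [set x | walk (f x) (f' x) p g = h].
Proof.
move=> mf mf'; rewrite /walk; elim/last_ind: (word g) h => [|w l IH] h /=.
  exact: measurable_cst_set.
under eq_set do rewrite foldl_rcons.
apply: (measurable_at (f := fun x => foldl (step (f x) (f' x)) p w)
  (P := fun q => [set x | step (f x) (f' x) q l = h])); [exact: countable_F2|exact: IH|].
by move=> q; rewrite /step; case: l => [[] []] //=; exact: measurable_cst_set.
Qed.

Lemma measurable_edge_labels :
  measurable_fun setT (@edge_labels K : sample -> pair_sample).
Proof.
apply: measurable_fun_prod_space => g; apply: measurable_fun_pair => _ B mB;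
  by rewrite setTI; exact: measurable_coord.
Qed.

Lemma measurable_next_b p h : measurable [set z : sample | next_b z p = h].
Proof.
exact: (measurable_preim measurable_edge_labels (measurable_end_slot (p * gen_b) h)).
Qed.

Lemma measurable_prev_b p h : measurable [set z : sample | prev_b z p = h].
Proof.
rewrite (_ : [set z | _] =
    @edge_labels K @^-1` [set w : pair_sample | slot_end w p = h * gen_b]).
  exact: (measurable_preim measurable_edge_labels (measurable_slot_end p _)).
apply/seteqP; split=> z; rewrite /prev_b /preimage /=; first by move=> <-; rewrite mulgVK.
by move=> ->; rewrite mulgK.
Qed.

Lemma measurable_rewire g h : measurable [set z : sample | rewire z g = h].
Proof.
apply: measurable_walk => q r; [exact: measurable_next_b|exact: measurable_prev_b].
Qed.

Lemma measurable_relabel : measurable_fun setT (@relabel K : sample -> pair_sample).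
Proof.
apply: measurable_fun_prod_space => g _ B mB; rewrite setTI.
apply: (measurable_at (f := fun z : sample => rewire z g)
  (P := fun h => [set z : sample | B (edge_labels z h)])).
- exact: countable_F2.
- exact: measurable_rewire.
- by move=> h; exact: (measurable_preim measurable_edge_labels (measurable_coord h mB)).
Qed.

Lemma measurable_unprev p h : measurable [set w : pair_sample | unprev w p = h].
Proof.
rewrite (_ : [set w | _] = [set w : pair_sample | end_slot w p = h * gen_b]).
  exact: measurable_end_slot.
apply/seteqP; split=> w; rewrite /unprev /=; first by move=> <-; rewrite mulgVK.
by move=> ->; rewrite mulgK.
Qed.

Lemma measurable_unrelabel : measurable_fun setT (@unrelabel K : pair_sample -> sample).
Proof.
apply: measurable_fun_prod_space => g _ B mB; rewrite setTI.
apply: (measurable_at (f := fun w : pair_sample => unrewire w g)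
  (P := fun h => [set w : pair_sample | B (w h).1])).
- exact: countable_F2.
- move=> h; apply: measurable_walk => q r; last exact: measurable_unprev.
  exact: measurable_slot_end.
- by move=> h; exact: measurable_fst_coord.
Qed.

Lemma measurable_perfect : measurable [set w : pair_sample | perfect w].
Proof.
apply: measurable_forall => [|g]; first exact: countable_F2.
apply: (@measurableI _ _ [set w : pair_sample | _] [set w : pair_sample | _]);
  apply: measurable_exists => [|k]; do ?[exact: countable_nat]; exact: measurable_matched.
Qed.

Lemma measurable_b_invariant : measurable [set w : pair_sample | b_invariant w].
Proof.
apply: measurable_forall => [|g]; first exact: countable_F2.
apply: (measurable_at (f := fun w : pair_sample => (w g).1)
  (P := fun t => [set w : pair_sample | (w (g * gen_b)).1 = t])).
- exact: countable_carrier.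
- by move=> t; exact: (measurable_fst_coord _ [set t]).
- by move=> t; exact: (measurable_fst_coord _ [set t]).
Qed.

Lemma measurable_perfect_edges :
  measurable [set z : sample | perfect (edge_labels z)].
Proof. exact: (measurable_preim measurable_edge_labels measurable_perfect). Qed.

End measurability.

(** * The matching is almost surely perfect *)

Section exponent.
Local Open Scope group_scope.
Local Open Scope ring_scope.
Implicit Types g : F2.

Definition a_weight (l : letter) : int := if l.1 then 0 else if l.2 then -1 else 1.

(** The homomorphism to the integers with [a] going to 1 and [b] to 0. Since [g] and [g * gen_b^-1]
    have the same value, it separates the labels read ahead of a point of [<a>] from those read
    behind it. *)
Definition a_exponent g : int := \sum_(l <- word g) a_weight l.

Lemma a_exponent_letter g l :
  a_exponent (g * letter_elt l)%g = a_exponent g + a_weight l.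
Proof.
have wV : a_weight (linv l) = - a_weight l.
  by case: l => [[] []]; rewrite /a_weight /= ?opprK ?oppr0.
have big_rcons' w l' : \sum_(i <- rcons w l') a_weight i =
    \sum_(i <- w) a_weight i + a_weight l'.
  by rewrite -cats1 big_cat big_seq1.
rewrite /a_exponent; case: (word_mul_letter g l) => ->; rewrite big_rcons'//.
by rewrite wV subrK.
Qed.

Lemma a_exponent_bV g : a_exponent (g * gen_b^-1)%g = a_exponent g.
Proof. by have := a_exponent_letter g (true, true); rewrite addr0. Qed.

Lemma a_exponent_a g : a_exponent (g * gen_a)%g = a_exponent g + 1.
Proof. by have := a_exponent_letter g (false, false). Qed.

Lemma a_exponent1 : a_exponent 1%g = 0.
Proof. by rewrite /a_exponent big_nil. Qed.

Lemma a_exponent_exp n : a_exponent (gen_a ^+ n)%g = n%:Z.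
Proof.
elim: n => [|n IH]; first exact: a_exponent1.
by rewrite expgSr a_exponent_a IH -addn1 PoszD.
Qed.

Lemma a_exponent_expV n : a_exponent (gen_a ^- n)%g = - n%:Z.
Proof.
apply: (addIr n%:Z); rewrite addNr.
suff H m g : a_exponent (g * gen_a ^+ m)%g = a_exponent g + m%:Z.
  by rewrite -H mulVg a_exponent1.
elim: m => [|m IH]; first by rewrite mulg1 addr0.
by rewrite expgSr mulgA a_exponent_a IH -addrA -PoszD addn1.
Qed.

End exponent.

Section almost_surely_perfect.
Local Open Scope group_scope.
Context (R : realType) d (K : countableDiscreteType d) (kappa : probability K R).
Notation sample := (prod_space F2 K).
Notation mu := (product_probability F2 kappa).
Implicit Types (z : sample) (g h : F2).

Definition translate h (A : set sample) : set sample := [set z | A (fun f => z (h * f))].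

Lemma measurable_translate h A : measurable A -> measurable (translate h A).
Proof. exact: (measurable_preim (@measurable_pullback _ K _ _ ( *%g h))). Qed.

Lemma translate_preserving h A : measurable A -> mu (translate h A) = mu A.
Proof. by apply: (product_probability_pullback kappa (e := *%g h)); exact: mulgI. Qed.

Lemma matched_translate z h k g :
  matched (edge_labels (fun f => z (h * f))) k g = matched (edge_labels z) k (h * g).
Proof.
apply: matched_equivariant; first by move=> f; rewrite mulgA.
by move=> f; rewrite edge_labels_translate.
Qed.

Section label.
Variable j : K.

Definition lonely_end : set sample :=
  [set z | z gen_b^-1 = j /\ free_end (edge_labels z) 1].
Definition lonely_slot : set sample :=
  [set z | z 1 = j /\ free_slot (edge_labels z) 1].

Lemma translate_lonely_slot h z : translate h lonely_slot z <->
  z h = j /\ free_slot (edge_labels z) h.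
Proof.
rewrite /translate /lonely_slot /free_slot /= mulg1.
have E k : matched (edge_labels (fun f => z (h * f))) k (1 * gen_a ^- k) =
    matched (edge_labels z) k (h * gen_a ^- k) by rewrite matched_translate mul1g.
by split=> -[zh H]; split=> // k; have := H k; rewrite E.
Qed.

Lemma translate_lonely_end h z : translate h lonely_end z <->
  z (h * gen_b^-1) = j /\ free_end (edge_labels z) h.
Proof.
rewrite /translate /lonely_end /free_end /=.
have E k : matched (edge_labels (fun f => z (h * f))) k 1 =
    matched (edge_labels z) k h by rewrite matched_translate mulg1.
by split=> -[zh H]; split=> // k; have := H k; rewrite E.
Qed.

Let measurable_value g : measurable [set z : sample | z g = j].
Proof.
by apply: (measurable_coord g (B := [set j])); exact: discrete_measurableE.
Qed.

Let measurable_edge_matched k g :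
  measurable [set z : sample | matched (edge_labels z) k g].
Proof.
exact: (measurable_preim (@measurable_edge_labels _ K) (measurable_matched k g)).
Qed.

Lemma measurable_lonely_end : measurable lonely_end.
Proof.
apply: (@measurableI _ _ [set z : sample | _] [set z : sample | _]) => //.
apply: measurable_forall => [|k]; first exact: countable_nat.
exact: measurable_negb.
Qed.

Lemma measurable_lonely_slot : measurable lonely_slot.
Proof.
apply: (@measurableI _ _ [set z : sample | _] [set z : sample | _]) => //.
apply: measurable_forall => [|k]; first exact: countable_nat.
exact: measurable_negb.
Qed.

(* Mass transport: an open end labelled j matched at distance k sees a slot
   labelled j, and translating by a^k exchanges the two points of view. *)
Lemma lonely_end_slot : mu lonely_end = mu lonely_slot.
Proof.
pose Y := [set z : sample | z gen_b^-1 = j]; pose X := [set z : sample | z 1 = j].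
pose MY := [set z : sample | exists k, matched (edge_labels z) k 1].
pose MX := [set z : sample | exists k, matched (edge_labels z) k (1 * gen_a ^- k)].
have mMY : measurable MY.
  rewrite /MY; apply: measurable_exists => [|k]; [exact: countable_nat|exact: measurable_edge_matched].
have mMX : measurable MX.
  rewrite /MX; apply: measurable_exists => [|k]; [exact: countable_nat|exact: measurable_edge_matched].
have endE : lonely_end = Y `\` MY.
  apply/seteqP; split=> z [zY H]; split=> //; first by move=> [k]; apply/negP; exact: H.
  by move=> k; apply/negP => m; apply: H; exists k.
have slotE : lonely_slot = X `\` MX.
  apply/seteqP; split=> z [zX H]; split=> //.
    by move=> [k]; apply/negP; exact: H.
  by move=> k; apply/negP => m; apply: H; exists k.
have YX : mu Y = mu X by rewrite !(product_probability1 kappa _ [set j]).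
have matchedYX : mu (Y `&` MY) = mu (X `&` MX).
  pose NY z := xget 0%N [set k | matched (edge_labels z) k 1].
  pose NX z := xget 0%N [set k | matched (edge_labels z) k (1 * gen_a ^- k)].
  apply: (measure_partition_eq (f := fun z : sample => NY z)
    (g := fun z : sample => NX z)); first exact: countable_nat.
  - move=> k; apply: measurable_first => [k'|z]; first exact: measurable_edge_matched.
    exact: matched_inj1.
  - move=> k; apply: measurable_first => [k'|z]; first exact: measurable_edge_matched.
    exact: matched_inj2.
  - by apply: measurableI => //; exact: measurable_value.
  - by apply: measurableI => //; exact: measurable_value.
  - move=> k.
    pose Yk := [set z : sample | z gen_b^-1 = j /\ matched (edge_labels z) k 1].
    have mYk : measurable Yk.
      apply: (@measurableI _ _ [set z : sample | _] [set z : sample | _]).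
        exact: measurable_value.
      exact: measurable_edge_matched.
    rewrite (_ : Y `&` _ `&` _ = Yk); last first.
      apply/seteqP; split=> [z [[zY /(xgetPex 0%N) m] /= NYk]|z [zY m]].
        by split=> //; rewrite -NYk.
      split; first by split=> //; exists k.
      apply: (@matched_inj1 _ (edge_labels z) 1) => //.
      exact: (@xgetI _ 0%N [set k | matched (edge_labels z) k 1] k m).
    rewrite (_ : X `&` _ `&` _ = translate (gen_a ^- k) Yk) ?translate_preserving//.
    have label z : matched (edge_labels z) k (gen_a ^- k) ->
        z (gen_a ^- k * gen_b^-1) = z 1.
      by case/and3P => _ _ /eqP; rewrite mulVg.
    apply/seteqP; split=> z.
      move=> [[zX /(xgetPex 0%N) m] NXk].
      have {}m : matched (edge_labels z) k (gen_a ^- k) by rewrite -[gen_a ^- k]mul1g -NXk.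
      by split; rewrite ?matched_translate ?mulg1//= label.
    move=> [/= zY]; rewrite matched_translate mulg1 => m.
    split; first by split; [rewrite /X /= -(label z)|exists k; rewrite mul1g].
    apply: (@matched_inj2 _ (edge_labels z) 1); last by rewrite mul1g.
    apply: (@xgetI _ 0%N [set k | matched (edge_labels z) k (1 * gen_a ^- k)] k).
    by rewrite /= mul1g.
have fY : mu (Y `&` MY) \is a fin_num.
  by rewrite fin_num_measure//; apply: measurableI => //; exact: measurable_value.
have HY : mu Y = (mu (Y `\` MY) + mu (Y `&` MY))%E.
  exact: (measureDI mu (measurable_value gen_b^-1) mMY).
have HX : mu X = (mu (X `\` MX) + mu (X `&` MX))%E.
  exact: (measureDI mu (measurable_value 1) mMX).
by rewrite endE slotE -[LHS](addeK _ fY) -HY YX HX -matchedYX addeK.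
Qed.

(** A lonely end and a lonely slot behind it depend on disjoint sets of labels, so the mass of their
    joint occurrence is a product, and a square by [lonely_end_slot]. The joint occurrence forces a
    last lonely slot on the line, which is a null event. *)
Lemma lonely_end_null : mu lonely_end = 0%E.
Proof.
(* The slot is placed at [gen_a^-1] so that it reads only levels below 0, while the end at 1 reads
   only levels from 0 upwards. *)
have indep : mu (lonely_end `&` translate gen_a^-1 lonely_slot) =
    (mu lonely_end * mu (translate (gen_a^-1)%g lonely_slot))%E.
  apply: (product_independence kappa (P := fun g => (0 <= a_exponent g)%R)).
  - exact: measurable_lonely_end.
  - by apply: measurable_translate; exact: measurable_lonely_slot.
  - move=> z z' zz' [zb fz]; split; first by rewrite -zz'//= -(mul1g gen_b^-1) a_exponent_bV a_exponent1.
    move=> k; rewrite -(@matched_local _ (edge_labels z)) => [|i _]; first exact: fz.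
    by rewrite /edge_labels !zz'// ?a_exponent_bV mul1g a_exponent_exp.
  - move=> z z' zz' /translate_lonely_slot[zb fz]; apply/translate_lonely_slot; split.
      by rewrite -zz'// (a_exponent_expV 1).
    move=> k; rewrite -(@matched_local _ (edge_labels z)) => [|i ik]; first exact: fz.
    rewrite mul_expV_exp// -[gen_a^-1]/(gen_a ^- 1) -invgM -expgnDr.
    by rewrite /edge_labels !zz'// ?a_exponent_bV a_exponent_expV addn1.
(* [G] says that the last lonely slot of the line is at 1. A lonely end at 1 leaves no free slot of
   label [j] from 1 onwards, so a lonely slot at [gen_a^-1] is then the last one. *)
pose G := lonely_slot `&` [set z | forall m, ~ translate (gen_a ^+ m.+1) lonely_slot z].
have mG : measurable G.
  apply: measurableI; first exact: measurable_lonely_slot.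
  apply: measurable_forall => [|m]; first exact: countable_nat.
  by apply: measurableC; apply: measurable_translate; exact: measurable_lonely_slot.
have G0 : mu G = 0%E.
  apply: (@trivIset_const_measure0 _ _ _ mu (fun n => translate (gen_a ^+ n) G)).
  - by move=> n; exact: measurable_translate.
  - have lt m n : (m < n)%N -> translate (gen_a ^+ m) G `&` translate (gen_a ^+ n) G = set0.
      move=> mn; apply/seteqP; split=> // z [[_ /(_ (n - m.+1)%N) H] [S _]]; apply: H.
      move: S; rewrite /translate /=; congr lonely_slot; apply/funext => f.
      by rewrite mulgA -expgnDr subnSK// subnKC// ltnW.
    move=> m n _ _ [z [zm zn]]; case: (ltngtP m n) => // /lt.
      by move/seteqP => [/(_ z) H _]; exfalso; apply: H.
    by move/seteqP => [/(_ z) H _]; exfalso; apply: H.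
  - by move=> n; exact: translate_preserving.
have : mu (lonely_end `&` translate gen_a^-1 lonely_slot) = 0%E.
  apply: (subset_measure0 (B := translate gen_a^-1 G)).
  - apply: measurableI; first exact: measurable_lonely_end.
    by apply: measurable_translate; exact: measurable_lonely_slot.
  - exact: measurable_translate.
  - move=> z [[zb fz] S]; split=> // m.
    rewrite /translate /= => S'; have : translate (gen_a ^+ m) lonely_slot z.
      move: S'; rewrite /translate /=; congr lonely_slot; apply/funext => f.
      by rewrite expgS !mulgA mulVg mul1g.
    move/translate_lonely_slot => [zm fm].
    have := free_clash (n := m) fz; rewrite mul1g => /(_ fm); apply.
    by rewrite /edge_labels /= mul1g zb zm.
  - exact: (etrans (translate_preserving _ mG) G0).
rewrite indep translate_preserving; last exact: measurable_lonely_slot.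
by rewrite -lonely_end_slot => /eqP; rewrite mule_eq0 orbb => /eqP.
Qed.

End label.

Lemma perfect_ae : mu (~` [set z | perfect (edge_labels z)]) = 0%E.
Proof.
pose bad := \bigcup_j (lonely_end j `|` lonely_slot j).
have mbad1 j : measurable (lonely_end j `|` lonely_slot j).
  by apply: measurableU; [exact: measurable_lonely_end|exact: measurable_lonely_slot].
have mbad : measurable bad.
  by apply: countable_bigcupT_measurable => //; exact: countable_carrier.
apply: (subset_measure0 (B := \bigcup_g translate g bad)).
- by apply: measurableC; exact: (@measurable_perfect_edges _ K).
- apply: countable_bigcupT_measurable => [|g]; first exact: countable_F2.
  exact: (measurable_translate g mbad).
- move=> z /= /existsNP[g /not_andP[/forallNP|/forallNP] H]; exists g => //.
    exists (z (g * gen_b^-1)) => //; left; apply/translate_lonely_end; split=> // k.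
    exact/negP.
  exists (z g) => //; right; apply/translate_lonely_slot; split=> // k.
  exact/negP.
- apply: measure0_bigcup => [|g|g]; first exact: countable_F2.
    exact: (measurable_translate g mbad).
  rewrite (translate_preserving g mbad); apply: (measure0_bigcup _ mbad1) => [|j].
    exact: countable_carrier.
  have slot0 : mu (lonely_slot j) = 0%E by rewrite -lonely_end_slot lonely_end_null.
  apply: (etrans (measureU0 (measurable_lonely_end j) (measurable_lonely_slot j) slot0)).
  exact: lonely_end_null.
Qed.

End almost_surely_perfect.

(** * Markov measures on labellings of the tree *)

Section connected_sets.
Local Open Scope group_scope.
Implicit Types (S Q : set F2) (u v : F2).

(** Connectedness in the Cayley tree, put as an induction principle so that no paths are needed. *)
Definition connected_set S := forall u Q, S u -> Q u ->
  (forall v l, S v -> S (v * letter_elt l) -> Q v -> Q (v * letter_elt l)) ->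
  forall v, S v -> Q v.

Definition a_closed S := forall v w, S v -> in_a w -> S (v * w).

Definition adjoin_line S q : set F2 := [set v | S v \/ in_a (q^-1 * v)].

Lemma line_connected q u Q : in_a (q^-1 * u) -> Q u ->
  (forall v l, in_a (q^-1 * v) -> in_a (q^-1 * (v * letter_elt l)) ->
     Q v -> Q (v * letter_elt l)) ->
  forall v, in_a (q^-1 * v) -> Q v.
Proof.
move=> au Qu Qs v av; rewrite -(mulVKg u v).
suff [] : in_a (q^-1 * (u * (u^-1 * v))) /\ Q (u * (u^-1 * v)) by [].
apply: (in_a_ind (Q := fun x => in_a (q^-1 * x) /\ Q x)) => //.
- move=> x [ax Qx]; have ax' : in_a (q^-1 * (x * gen_a)) by rewrite mulgA in_aM.
  by split=> //; apply: (Qs x (false, false)).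
- move=> x [ax Qx]; have ax' : in_a (q^-1 * (x * gen_a^-1)) by rewrite mulgA in_aM.
  by split=> //; have := Qs x (false, true); rewrite letter_eltE; apply.
- have -> : u^-1 * v = (q^-1 * u)^-1 * (q^-1 * v).
    by rewrite invgM invgK -mulgA mulVKg.
  by rewrite in_aM ?in_aV.
Qed.

Lemma connected_in_a : connected_set [set v | in_a v].
Proof.
by move=> u Q Su Qu Qs v av; apply: (@line_connected 1 u); rewrite ?invg1 ?mul1g.
Qed.

Lemma connected_adjoin S u l : connected_set S -> S u ->
  connected_set (adjoin_line S (u * letter_elt l)).
Proof.
set q := u * _ => cS Su u0 Q S'u0 Qu0 Qs.
have S'q : adjoin_line S q q by right; rewrite /= mulVg.
have line x : in_a (q^-1 * x) -> Q x -> forall v, in_a (q^-1 * v) -> Q v.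
  by move=> ax Qx; apply: line_connected ax Qx _ => v l' av avl; apply: Qs; right.
have inS x : S x -> Q x -> forall v, S v -> Q v.
  by move=> Sx Qx; apply: cS Sx Qx _ => v l' Sv Svl; apply: Qs; left.
have S'u : adjoin_line S q u by left.
have aq : in_a (q^-1 * q) by rewrite mulVg.
have uE : q * letter_elt (linv l) = u by rewrite letter_elt_linv mulgK.
case: S'u0 => [Su0|au0].
  have QS := inS _ Su0 Qu0; have Qq : Q q by apply: Qs => //; exact: QS.
  by move=> v [/QS//|]; exact: line aq Qq v.
have QL := line _ au0 Qu0; have Qu : Q u.
  by rewrite -uE; apply: Qs; rewrite ?uE//; exact: QL.
by move=> v [|/QL//]; exact: inS Su Qu v.
Qed.

Lemma a_closed_adjoin S q : a_closed S -> a_closed (adjoin_line S q).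
Proof.
move=> aS v w [Sv|av] aw; [left; exact: aS|right].
by rewrite /= mulgA in_aM.
Qed.

(** To pass beyond the edge from [u] to [u * gen_b], a connected set would have to contain the far
    end of that edge. *)
Lemma connected_half_bN S u : connected_set S -> S u -> ~ S (u * gen_b) ->
  forall v, S (u * v) -> ~~ half_b v.
Proof.
move=> cS Su Sub v Suv; rewrite -(mulKg u v).
apply: (cS u (fun x => ~~ half_b (u^-1 * x)) Su _ _ _ Suv); first by rewrite mulVg.
move=> x l Sx Sxl; rewrite mulgA letter_eltE in Sxl *.
case: l Sxl => [[] []] /= Sxl hx.
- by apply: contra hx => h; rewrite half_b_mulbV h.
- rewrite half_b_mulb (negPf hx) /=; apply/eqP => ux1; apply: Sub.
  by rewrite (_ : u = x)// -(mulVKg u x) ux1 mulg1.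
- by rewrite half_b_mulaV.
- by rewrite half_b_mula.
Qed.

Lemma connected_half_b S p : connected_set S -> ~ S p -> S (p * gen_b) ->
  forall v, S (p * v) -> half_b v.
Proof.
move=> cS Sp Spb v Spv; rewrite -(mulKg p v).
apply: (cS (p * gen_b) (fun x => half_b (p^-1 * x)) Spb _ _ _ Spv).
  by rewrite mulKg.
move=> x l Sx Sxl; rewrite mulgA letter_eltE in Sxl *.
case: l Sxl => [[] []] /= Sxl hx.
- move: hx; rewrite half_b_mulbV => /orP[//|/eqP pxb]; case: Sp.
  have <- // : x * gen_b^-1 = p.
  by rewrite -(mulVKg p x) pxb mulgK.
- by rewrite half_b_mulb hx.
- by rewrite half_b_mulaV.
- by rewrite half_b_mula.
Qed.

End connected_sets.

Section tree_markov.
Local Open Scope group_scope.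
Context (R : realType) d (K : countableDiscreteType d) (kappa : probability K R).
Notation pair_sample := (prod_space F2 (K * K)%type).
Implicit Types (nu : probability pair_sample R) (l : seq (F2 * set (K * K))).

Lemma discrete_pair_measurable (B : set (K * K)) : measurable B.
Proof.
rewrite (_ : B = [set x | B (x.1, x.2)]); last by apply/seteqP; split=> -[].
apply: (measurable_at (f := fst) (P := fun s => [set x : K * K | B (s, x.2)])).
- exact: countable_carrier.
- move=> s; exact: (measurable_preim measurable_fst (discrete_measurableE [set s])).
- move=> s; apply: (measurable_preim measurable_snd (B := [set t | B (s, t)])).
  exact: discrete_measurableE.
Qed.

Fixpoint box l : set pair_sample :=
  if l is p :: l' then [set w | p.2 (w p.1)] `&` box l' else setT.

Fixpoint box_on (S : set F2) l : Prop :=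
  if l is p :: l' then S p.1 /\ box_on S l' else True.

Lemma measurable_box l : measurable (box l).
Proof.
elim: l => //= p l IH; apply: measurableI => //.
by apply: measurable_coord; exact: discrete_pair_measurable.
Qed.

Lemma box_cat l1 l2 : box (l1 ++ l2) = box l1 `&` box l2.
Proof. by elim: l1 => /= [|p l1 ->]; rewrite ?setTI ?setIA. Qed.

Lemma box_onS (S S' : set F2) l : S `<=` S' -> box_on S l -> box_on S' l.
Proof. by move=> SS'; elim: l => //= p l IH [/SS' ? /IH]. Qed.

Lemma box_local S l w w' : box_on S l -> (forall g, S g -> w g = w' g) ->
  box l w -> box l w'.
Proof. by move=> + ww'; elim: l => //= p l IH [Sp Sl] [/= wp wl]; split; [rewrite /= -ww'|exact: IH]. Qed.

Lemma box_on_split S S' l : box_on (S `|` S') l ->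
  exists l1 l2, [/\ box_on S l1, box_on S' l2 & box l = box l1 `&` box l2].
Proof.
elim: l => /= [_|p l IH [Sp /IH[l1 [l2 [S1 S2 ->]]]]].
  by exists [::], [::]; rewrite setTI.
case: Sp => Sp; [exists (p :: l1), l2|exists l1, (p :: l2)]; split=> //=.
  by rewrite setIA.
by rewrite setICA.
Qed.

Definition translate_box g l := [seq (g * p.1, p.2) | p <- l].

Lemma translate_boxE g l : box (translate_box g l) = Defs.shift (g^-1)%g @^-1` box l.
Proof.
elim: l => //= p l ->; apply/seteqP; split=> w [/= wp wl]; split=> //=;
  by move: wp; rewrite /Defs.shift invgK.
Qed.

Lemma translate_box_on S g l : box_on (fun v => S (g * v)) l ->
  box_on S (translate_box g l).
Proof. by elim: l => //= p l IH [? /IH]. Qed.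

Definition agree nu nu' S := forall l, box_on S l -> nu (box l) = nu' (box l).

(** In [markov_edge] the label of the edge is read at 1 by the near side and at [gen_b] by the far
    side. The identity is conditional independence given this label, cleared of denominators so that
    labels of mass 0 need no exception. *)
Record tree_markov nu : Prop := TreeMarkov {
  markov_shift : forall g C, measurable C -> nu (Defs.shift g @^-1` C) = nu C ;
  markov_label : forall k, nu [set w | (w 1).1 = k] = kappa [set k] ;
  markov_edge : forall (E H : set pair_sample) k, measurable E -> measurable H ->
    (forall w w', (forall g, ~~ half_b g -> w g = w' g) -> E w -> E w') ->
    (forall w w', (forall g, half_b g -> w g = w' g) -> H w -> H w') ->
    (nu (E `&` [set w | (w 1%g).1 = k]) * nu (H `&` [set w | (w gen_b).1 = k]) =
     nu (E `&` H `&` [set w | (w 1%g).1 = k]) * kappa [set k])%E }.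

Section uniqueness.
Context nu nu' (mnu : tree_markov nu) (mnu' : tree_markov nu').

Let measurable_label g k : measurable [set w : pair_sample | (w g).1 = k].
Proof.
apply: (measurable_coord g (B := [set x : K * K | x.1 = k])).
exact: discrete_pair_measurable.
Qed.

Lemma agree_translate S g : agree nu nu' S -> agree nu nu' (fun v => S (g * v)).
Proof.
move=> aS l /translate_box_on/aS; rewrite translate_boxE.
by rewrite (markov_shift mnu)// ?(markov_shift mnu')//; exact: measurable_box.
Qed.

(** Once the label [k] of the edge is fixed, [markov_edge] expresses the joint mass through the
    masses on [S] and [S'], where the laws agree; 1 and [gen_b] lie in these sets so that each can
    test the label. Cancelling [kappa [set k]] requires it to be positive, and labels of mass 0
    contribute nothing. *)
Lemma agree_glue (S S' : set F2) : (forall g, S g -> ~~ half_b g) ->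
  (forall g, S' g -> half_b g) -> S 1 -> S' gen_b ->
  agree nu nu' S -> agree nu nu' S' -> agree nu nu' (S `|` S').
Proof.
move=> hS hS' S1 S'b aS aS' l /box_on_split[l1 [l2 [Sl1 S'l2 ->]]].
have m1 := measurable_box l1; have m2 := measurable_box l2.
apply: (measure_partition_eq (f := fun w : pair_sample => (w 1).1)
  (g := fun w : pair_sample => (w 1).1)) => //; do ?exact: measurableI.
  exact: countable_carrier.
move=> k.
have mL g := measurable_label g k.
have mI : measurable (box l1 `&` box l2 `&` [set w | (w 1).1 = k]).
  by apply: measurableI => //; exact: measurableI.
have [k0|k0] := eqVneq (kappa [set k]) 0%E.
  have null n : tree_markov n -> n (box l1 `&` box l2 `&` [set w | (w 1).1 = k]) = 0%E.
    move=> mn; apply: (subset_measure0 mI (mL 1)); first by move=> w [].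
    exact: (etrans (markov_label mn k) k0).
  by rewrite (null _ mnu) (null _ mnu').
have loc1 w w' : (forall g, ~~ half_b g -> w g = w' g) -> box l1 w -> box l1 w'.
  by move=> ww'; apply: box_local Sl1 _ => g /hS; exact: ww'.
have loc2 w w' : (forall g, half_b g -> w g = w' g) -> box l2 w -> box l2 w'.
  by move=> ww'; apply: box_local S'l2 _ => g /hS'; exact: ww'.
have e1 := markov_edge mnu k m1 m2 loc1 loc2.
have e2 := markov_edge mnu' k m1 m2 loc1 loc2.
have a1 : nu (box l1 `&` [set w | (w 1).1 = k]) = nu' (box l1 `&` [set w | (w 1).1 = k]).
  by rewrite setIC; apply: (aS ((1, [set x | x.1 = k]) :: l1)).
have a2 : nu (box l2 `&` [set w | (w gen_b).1 = k]) =
    nu' (box l2 `&` [set w | (w gen_b).1 = k]).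
  by rewrite setIC; apply: (aS' ((gen_b, [set x | x.1 = k]) :: l2)).
have kfin : kappa [set k] \is a fin_num.
  by apply: fin_num_measure; exact: discrete_measurableE.
have kpos : (0 < kappa [set k])%E by rewrite lt0e k0 /=.
rewrite a1 a2 e2 in e1.
apply: le_anti.
by rewrite -(lee_pmul2r kfin kpos) e1 lexx -(lee_pmul2r kfin kpos) e1 lexx.
Qed.

Lemma agree_subset (S S' : set F2) : S' `<=` S -> agree nu nu' S -> agree nu nu' S'.
Proof. by move=> S'S aS l /(box_onS S'S); exact: aS. Qed.

(** A connected union of cosets of [<a>] is enlarged by one coset across a [b]-edge. In a tree the
    new coset and the old set lie on different sides of that edge, so they can be glued; a box
    involves finitely many vertices and is reached after finitely many enlargements. *)
Lemma agree_all : agree nu nu' [set v | in_a v] -> agree nu nu' setT.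
Proof.
move=> aA.
pose good (S : set F2) := [/\ S 1, a_closed S, connected_set S & agree nu nu' S].
have good0 : good [set v | in_a v].
  by split=> //; [exact: in_aM|exact: connected_in_a].
have good_adjoin S u (l : letter) : good S -> S u -> good (adjoin_line S (u * letter_elt l)).
  move=> [S1 aS cS gS] Su; set q := u * _.
  have [Sq|Sq] := pselect (S q).
    rewrite (_ : adjoin_line S q = S)//; apply/seteqP; split=> v; last by left.
    by case=> // /(aS q _ Sq); rewrite mulVKg.
  split; [by left|exact: a_closed_adjoin|exact: connected_adjoin|].
  move: Sq; rewrite /q letter_eltE {q}; case: l => [[] []] /= Sub.
  (* For an inverse letter the roles are exchanged: rooted at [p], the new line is on the near side
     and the old set on the far side. *)
  - pose p := u * gen_b^-1.
    have Spb : S (p * gen_b) by rewrite mulgVK.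
    apply: (@agree_subset (fun v => ([set v | in_a v] `|` [set v | S (p * v)]) (p^-1 * v))).
      by move=> v [Sv|av]; [right; rewrite /= mulVKg|left].
    apply: agree_translate; apply: agree_glue => //.
    + by move=> g ag; rewrite /= -[g]mul1g half_b_in_a.
    + exact: (connected_half_b cS Sub Spb).
    + exact: (@agree_translate S p gS).
  - apply: (@agree_subset (fun v =>
        ([set v | S (u * v)] `|` [set v | in_a (gen_b^-1 * v)]) (u^-1 * v))).
      move=> v [Sv|av]; [left; rewrite /= mulVKg//|right].
      by rewrite /= mulgA -invgM.
    apply: agree_translate; apply: agree_glue => //.
    + exact: (connected_half_bN cS Su Sub).
    + by move=> g ag; rewrite -(mulVKg gen_b g) half_b_in_a.
    + by rewrite /= mulg1.
    + exact: (@agree_translate S u gS).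
    + exact: (@agree_translate [set v | in_a v] gen_b^-1 aA).
  - by case: Sub; apply: aS => //; exact: in_a_genV.
  - by case: Sub; exact: aS.
have reach g : forall S, good S -> exists S', [/\ good S', S `<=` S' & S' g].
  elim/F2_ind_right: g => [|g l _ IH] S gS; first by exists S; split=> //; case: gS.
  have [S' [gS' SS' S'g]] := IH S gS.
  exists (adjoin_line S' (g * letter_elt l)); split; first exact: good_adjoin.
    by move=> v /SS'; left.
  by right; rewrite /= mulVg.
move=> l _; suff [S [[_ _ _ aS] Sl]] : exists S, good S /\ box_on S l by exact: aS.
elim: l => [|p l [S [gS Sl]]]; first by exists [set v | in_a v].
have [S' [gS' SS' S'p]] := reach p.1 S gS.
by exists S'; split=> //=; split=> //; exact: box_onS Sl.
Qed.

Lemma markov_unique : agree nu nu' [set v | in_a v] ->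
  forall C, measurable C -> nu C = nu' C.
Proof.
move=> /agree_all aT.
apply: (measure_unique (range box) (fun=> setT)) => //.
- apply/seteqP; split.
    apply: smallest_sub; first exact: smallest_sigma_algebra.
    move=> _ [i [B mB ->]]; apply: sub_sigma_algebra.
    by exists [:: (i, B)] => //=; rewrite setIT.
  apply: smallest_sub; first exact: smallest_sigma_algebra.
  by move=> _ [l _ <-]; exact: measurable_box.
- move=> _ _ [l1 _ <-] [l2 _ <-]; exists (l1 ++ l2) => //; exact: box_cat.
- by move=> _; exists [::].
- by rewrite bigcup_const.
- move=> _ [l _ <-]; apply: aT; elim: l => //= p l IH; split => //.
- by move=> _; rewrite [X in (X < _)%E]probability_setT ltry.
Qed.

End uniqueness.
End tree_markov.

(** * Left cosets of [<b>] and the two sides of an edge *)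

Section cosets_of_b.
Local Open Scope group_scope.
Implicit Types g h : F2.

Lemma coset_b_gen g : coset_b (g * gen_b) = coset_b g.
Proof.
apply/val_inj; rewrite /= /lcoset_b; apply/seteqP; split=> _ [h [n [->|->]] <-] /=.
- by exists (gen_b ^+ n.+1); [exists n.+1; left|rewrite expgS mulgA].
- case: n => [|n]; first by exists gen_b; [exists 1%N; left|rewrite invg1 mulg1].
  exists (gen_b ^- n); first by exists n; right.
  by rewrite expgSr invgM -mulgA mulVKg.
- case: n => [|n]; last by exists (gen_b ^+ n); [exists n; left|rewrite expgS mulgA].
  by exists gen_b^-1; [exists 1%N; right|rewrite mulgK mulg1].
- exists (gen_b ^- n.+1); first by exists n.+1; right.
  by rewrite expgSr invgM mulgA mulgK.
Qed.

Lemma coset_b_genV g n : coset_b (g * gen_b ^- n) = coset_b g.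
Proof.
elim: n => [|n IH]; first by rewrite invg1 mulg1.
by rewrite expgS invgM mulgA -[LHS]coset_b_gen mulgVK.
Qed.

Lemma coset_b_eq g h : coset_b g = coset_b h ->
  exists n, h = g * gen_b ^+ n \/ h = g * gen_b ^- n.
Proof.
move=> /(congr1 val) /= e; have : lcoset_b h h.
  by exists 1; [exists 0%N; left|rewrite mulg1].
by rewrite -e => -[_ [n [->|->]] <-]; exists n; [left|right].
Qed.

Lemma half_b_exp g n : half_b g -> half_b (g * gen_b ^+ n).
Proof.
by move=> hg; elim: n => [|n IH]; rewrite ?mulg1// expgSr mulgA half_b_mulb IH.
Qed.

(** A coset of [<b>] is a line of [b]-edges, so it meets both sides only by running through the edge
    from 1 to [gen_b]. Hence the two sides share a single coset label. *)
Lemma coset_b_crossing g h : half_b g -> ~~ half_b h -> coset_b g = coset_b h ->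
  coset_b g = coset_b 1.
Proof.
move=> hg hh /coset_b_eq[n [hE|hE]]; rewrite {}hE in hh.
  by rewrite half_b_exp in hh.
elim: n hh => [|n IH]; first by rewrite invg1 mulg1 hg.
rewrite expgS invgM mulgA => hh; have [hgn|] := boolP (half_b (g * gen_b ^- n)).
  move: hgn; rewrite half_b_mulbV (negPf hh) /= => /eqP e.
  by rewrite -(coset_b_genV g n) e -[gen_b]mul1g coset_b_gen.
exact: IH.
Qed.

Lemma in_a_expb n : in_a (gen_b ^+ n) -> n = 0%N.
Proof.
case: n => // n /(half_b_in_a 1); rewrite mul1g half_b1 expgS.
by rewrite half_b_exp.
Qed.

(** [<a>] and [<b>] meet trivially; this makes the coset labels seen along [<a>] independent. *)
Lemma coset_b_in_a_inj g h : in_a g -> in_a h -> coset_b g = coset_b h -> g = h.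
Proof.
move=> ag ah /coset_b_eq[n hE].
have : in_a (g^-1 * h) by rewrite in_aM ?in_aV.
case: hE => ->; rewrite mulKg; first by move/in_a_expb => ->; rewrite mulg1.
by move/in_aV; rewrite invgK => /in_a_expb ->; rewrite invg1 mulg1.
Qed.

End cosets_of_b.

(** * Identification of the relabelled law with the target law *)

Section laws.
Local Open Scope group_scope.
Context (R : realType) d (K : countableDiscreteType d) (kappa : probability K R).
Notation sample := (prod_space F2 K).
Notation pair_sample := (prod_space F2 (K * K)%type).
Notation mu := (product_probability F2 kappa).
Implicit Types (z : sample) (w : pair_sample) (g h u : F2).

Definition relabel_map : sample -> pair_sample := @relabel K.

HB.instance Definition _ :=
  isMeasurableFun.Build _ _ _ _ relabel_map (@measurable_relabel _ K).

Definition relabel_law : probability pair_sample R := distribution mu relabel_map.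

Let X : set sample := [set z | perfect (edge_labels z)].

Let mX : measurable X. Proof. exact: measurable_perfect_edges. Qed.

Let X0 : mu (~` X) = 0%E. Proof. exact: perfect_ae. Qed.

Lemma perfect_edges_translate h z :
  perfect (edge_labels (fun f => z (h * f))) <-> perfect (edge_labels z).
Proof.
suff H h' z' : perfect (edge_labels z') -> perfect (edge_labels (fun f => z' (h' * f))).
  split=> [/(H h^-1)|]; last exact: H.
  by rewrite (_ : (fun f => z (h * (h^-1 * f))) = z)//; apply/funext => f; rewrite mulVKg.
by rewrite edge_labels_translate; exact: perfect_translate.
Qed.

Let measurable_rewire_translate u (D : set sample) : measurable D ->
  measurable [set z : sample | D (fun f => z (rewire z u * f))].
Proof.
move=> mD; apply: (measurable_at (f := fun z : sample => rewire z u)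
  (P := fun h => translate h D)).
- exact: countable_F2.
- exact: measurable_rewire.
- by move=> h; exact: measurable_translate.
Qed.

(** On the piece where [rewire z u = h] the move is translation by [h]. Seen from the new root the
    old one lies at [h^-1], the value of [rewire] at [u^-1] for the moved sample. The images of the
    pieces are therefore the level sets of [(rewire z u^-1)^-1], and again form a partition. *)
Lemma rewire_translate_preserving u (D : set sample) : measurable D ->
  mu [set z : sample | D (fun f => z (rewire z u * f))] = mu D.
Proof.
move=> mD.
have mVD := measurable_rewire_translate u mD.
transitivity (mu (D `&` X)); last first.
  by apply: (measure_eq_on (N := X)) => //; [exact: measurableI|move=> z Xz; split=> [[]|]].
transitivity (mu ([set z : sample | D (fun f => z (rewire z u * f))] `&` X)).
  by apply: (measure_eq_on (N := X)) => //; [exact: measurableI|move=> z Xz; split=> [|[]]].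
have mr g h : measurable [set z : sample | rewire z g = h] by exact: measurable_rewire.
have mrV h : measurable [set z : sample | (rewire z u^-1)^-1 = h].
  rewrite (_ : [set _ | _] = [set z : sample | rewire z u^-1 = h^-1])//.
  by apply/seteqP; split=> z /=; [move=> <-; rewrite invgK|move=> ->; rewrite invgK].
apply: (measure_partition_eq (f := fun z : sample => rewire z u)
  (g := fun z : sample => (rewire z u^-1)^-1) countable_F2 (mr u) mrV);
  [exact: measurableI|exact: measurableI|].
move=> h; rewrite -(translate_preserving kappa h (A := _ `&` [set z : sample | (rewire z u^-1)^-1 = h])).
  congr (mu _); apply/seteqP; split=> z.
    move=> [[/= Dz Xz] zu]; rewrite zu in Dz; split.
      by split=> //; exact/perfect_edges_translate.
    rewrite /=; apply: invg_inj; rewrite invgK; apply: (mulgI h).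
    by rewrite mulgV -[X in X * _]zu -{1}zu rewire_translate_rewire// mulgV.
  move=> [[/= Dz /perfect_edges_translate Xz] zu].
  suff zuh : rewire z u = h by split=> //; split; rewrite /= ?zuh.
  have Xw : perfect (edge_labels (fun f => z (h * f))) by exact/perfect_edges_translate.
  have := rewire_translate_rewire u^-1 u Xw.
  have -> : rewire (fun f => z (h * f)) u^-1 = h^-1.
    by apply: invg_inj; rewrite invgK; exact: zu.
  rewrite mulVg (_ : (fun f => z (h * (h^-1 * f))) = z).
    by move/mulg1_eq; rewrite invgK => <-.
  by apply/funext => f; rewrite mulVKg.
by apply: measurableI => //; exact: measurableI.
Qed.

Lemma markov_relabel : tree_markov kappa relabel_law.
Proof.
have mrl C : measurable C -> measurable (relabel_map @^-1` C).
  by move=> mC; apply: measurable_preim => //; exact: measurable_relabel.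
have mshift g (C : set pair_sample) : measurable C -> measurable (Defs.shift g @^-1` C).
  by move=> mC; apply: measurable_preim => //; exact: measurable_shift.
split=> [g C mC|k|E H k mE mH locE locH].
- rewrite -[LHS]/(mu (relabel_map @^-1` (Defs.shift g @^-1` C))).
  rewrite -[RHS]/(mu (relabel_map @^-1` C)) -(rewire_translate_preserving g^-1 (mrl _ mC)).
  apply: (measure_eq_on (N := X)) => //; first by apply: mrl; exact: mshift.
    by apply: measurable_rewire_translate; exact: mrl.
  move=> z Xz; rewrite /preimage /= /relabel_map relabel_translate//.
- by rewrite -[RHS](product_probability1 kappa (1 : F2) [set k]).
- have mk : measurable [set z : sample | z 1 = k].
    by apply: (measurable_coord 1 (B := [set k])); exact: discrete_measurableE.
  have mkb g : measurable [set w : pair_sample | (w g).1 = k].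
    apply: (measurable_coord g (B := [set x : K * K | x.1 = k])).
    exact: discrete_pair_measurable.
  (* By [b]-invariance the label at [gen_b] is almost surely the one at 1, so both sides condition
     on the single coordinate [z 1]. *)
  have -> : relabel_law (H `&` [set w | (w gen_b).1 = k]) =
      mu (relabel_map @^-1` H `&` [set z | z 1 = k]).
    apply: (measure_eq_on (N := X)) => //.
    + by apply: mrl; apply: measurableI.
    + by apply: measurableI => //; exact: mrl.
    + move=> z Xz; have e : (relabel_map z gen_b).1 = z 1.
        by rewrite -[gen_b]mul1g [LHS](b_invariant_relabel Xz).
      split=> -[Hz zk]; split; try exact: Hz.
        exact: (etrans (esym e) zk).
      exact: (etrans e zk).
  have lawE C : relabel_law C = mu (relabel_map @^-1` C) by [].
  rewrite !lawE; apply: (product_conditional_independence (P := fun g => ~~ half_b g)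
    (c := 1 : F2) (X := X) (A := relabel_map @^-1` E) (B := relabel_map @^-1` H)) => //.
  + exact: mrl.
  + exact: mrl.
  + by move=> z z' Xz Xz' zz'; apply: locE; exact: relabel_half_bN.
  + move=> z z' Xz Xz' zz'; apply: locH; apply: relabel_half_b => // f.
    by move=> hf; apply: zz'; rewrite negbK.
Qed.

Let I := (F2modb + F2)%type.

(** The target process as a function of one i.i.d. family over cosets and vertices together, so that
    the exchange argument applies to it as well. *)
Definition coset_labels (s : prod_space I K) : pair_sample :=
  fun g => (s (inl (coset_b g)), s (inr g)).

Lemma measurable_coset_labels : measurable_fun setT coset_labels.
Proof.
apply: measurable_fun_prod_space => g; apply: measurable_fun_pair => _ B mB;
  by rewrite setTI; exact: measurable_coord.
Qed.

Lemma coset_bernoulliE C : measurable C ->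
  coset_bernoulli kappa C = product_probability I kappa (coset_labels @^-1` C).
Proof.
move=> mC; rewrite product_probability_merge//.
by apply: measurable_preim => //; exact: measurable_coset_labels.
Qed.

Lemma markov_coset : tree_markov kappa (coset_bernoulli kappa).
Proof.
have mcl C : measurable C -> measurable (coset_labels @^-1` C).
  by move=> mC; apply: measurable_preim => //; exact: measurable_coset_labels.
have mkb g k : measurable [set w : pair_sample | (w g).1 = k].
  apply: (measurable_coord g (B := [set x : K * K | x.1 = k])).
  exact: discrete_pair_measurable.
split=> [g C mC|k|E H k mE mH locE locH].
- exact: coset_bernoulli_preserving.
- rewrite coset_bernoulliE//.
  exact: (product_probability1 kappa (inl (coset_b 1) : I) [set k]).
- rewrite !coset_bernoulliE//; do ?[exact: measurableI];
    last by apply: measurableI => //; exact: measurableI.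
  (* These are the coordinates visible from the near side. The coset of 1 meets both sides and is
     counted here; it is the only coordinate the sides share. *)
  pose P (s : I) := match s with
    | inl c => `[< exists g, ~~ half_b g /\ coset_b g = c >]
    | inr g => ~~ half_b g
    end.
  rewrite (_ : coset_labels @^-1` (H `&` _) =
      coset_labels @^-1` H `&` [set s | s (inl (coset_b 1)) = k]); last first.
    by rewrite -[gen_b]mul1g; apply/seteqP; split=> s [Hs]; rewrite /= coset_b_gen.
  apply: (product_conditional_independence (P := P) (c := inl (coset_b 1) : I)
    (X := setT) (A := coset_labels @^-1` E) (B := coset_labels @^-1` H)) => //.
  + by apply/asboolP; exists 1.
  + by rewrite setCT.
  + exact: mcl.
  + exact: mcl.
  + move=> s s' _ _ ss'; apply: locE => g hg; congr (_, _); apply: ss' => //.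
    by apply/asboolP; exists g.
  + move=> s s' _ _ ss'; apply: locH => g hg; congr (_, _); apply: ss'.
      have [/asboolP[h [hh e]]|] := boolP (P (inl (coset_b g))) => //.
      by apply/orP; right; rewrite (coset_b_crossing hg hh (esym e)).
    by rewrite /P /= negbK hg.
Qed.

(* The labels seen along the cosets of a form an i.i.d. family in both laws. *)
Lemma agree_in_a : agree relabel_law (coset_bernoulli kappa) [set g | in_a g].
Proof.
pose A := {g : F2 | in_a g}; pose a1 : A := exist _ 1 in_a1.
pose line (v : prod_space (A + A)%type K) : pair_sample :=
  fun g => (v (inl (insubd a1 g)), v (inr (insubd a1 g))).
have mline : measurable_fun setT line.
  apply: measurable_fun_prod_space => g; apply: measurable_fun_pair => _ B mB;
    by rewrite setTI; exact: measurable_coord.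
(* [rewire] fixes the points of [<a>], so the two labels at [u] are read at [u] and [u * gen_b^-1];
   in the target they are read at the coset of [u] and at [u]. Neither list of places has a
   repetition. *)
pose e1 (s : A + A) : F2 :=
  match s with inl u => val u | inr u => val u * gen_b^-1 end.
pose e2 (s : A + A) : I :=
  match s with inl u => inl (coset_b (val u)) | inr u => inr (val u) end.
have cross (u u' : A) : val u <> val u' * gen_b^-1.
  move=> e; have : in_a ((val u')^-1 * val u) by rewrite in_aM ?in_aV ?(valP u) ?(valP u').
  by rewrite e mulKg.
have e1_inj : injective e1.
  move=> [u|u] [u'|u'] /=; first by move/val_inj->.
  - by move/cross.
  - by move/esym/cross.
  - by move/mulIg/val_inj->.
have e2_inj : injective e2.
  move=> [u|u] [u'|u'] //; last first.
    by case=> e; congr inr; exact: val_inj e.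
  move=> e; congr inl; apply: val_inj; apply: coset_b_in_a_inj (valP u) (valP u') _.
  exact: inl_inj e.
move=> l la; have mb := measurable_box l.
have mlb : measurable (line @^-1` box l) by exact: measurable_preim.
transitivity (product_probability (A + A)%type kappa (line @^-1` box l)).
  rewrite -(product_probability_pullback kappa e1_inj mlb).
  apply: (measure_eq_on (N := X)) => //.
  - by apply: measurable_preim => //; exact: measurable_relabel.
  - by apply: (measurable_preim (measurable_pullback _)).
  - move=> z Xz; have e g : in_a g -> relabel_map z g = line (pullback e1 z) g.
      move=> ag; rewrite /relabel_map /relabel -[g in LHS]mul1g.
      rewrite (a_equivariantM _ (rewire_a Xz) ag) mul1g.
      by rewrite /line /pullback /= insubdK.
    split; apply: box_local la _ => g ag; first exact: e.
    exact/esym/e.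
rewrite coset_bernoulliE// -(product_probability_pullback kappa e2_inj mlb).
have e s g : in_a g -> line (pullback e2 s) g = coset_labels s g.
  by move=> ag; rewrite /line /pullback /= insubdK.
congr (product_probability _ _ _); apply/seteqP; split=> s; apply: box_local la _ => g ag.
  exact: e.
exact/esym/e.
Qed.

Lemma relabel_lawE C : measurable C -> relabel_law C = coset_bernoulli kappa C.
Proof. exact: (markov_unique markov_relabel markov_coset agree_in_a). Qed.

End laws.

(** * The orbit equivalence *)

Theorem theorem1p3 (R : realType) (d : measure_display)
    (K : countableDiscreteType d) (kappa : probability K R) :
  orbit_equivalent (bernoulli_shift kappa) (coset_bernoulli_shift kappa).
Proof.
pose X1 : set (prod_space F2 K) := [set z | perfect (edge_labels z)].
pose X2 : set (prod_space F2 (K * K)%type) := [set w | perfect w /\ b_invariant w].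
pose mu := product_probability F2 kappa.
have mX1 : measurable X1 by exact: measurable_perfect_edges.
have mX2 : measurable X2.
  apply: (@measurableI _ _ [set w : prod_space F2 (K * K)%type | _] [set w | _]).
    exact: measurable_perfect.
  exact: measurable_b_invariant.
have X10 : mu (~` X1) = 0%E by exact: perfect_ae.
have relabelX2 z : X1 z -> X2 (relabel z).
  by move=> pz; split; [exact: perfect_relabel|exact: b_invariant_relabel].
have mrelabel := @measurable_relabel _ K.
(* [X2] is conull because [relabel] maps the conull set [X1] into it and carries [mu] to the target
   law. *)
have X20 : coset_bernoulli kappa (~` X2) = 0%E.
  rewrite -relabel_lawE; last exact: measurableC.
  apply: (subset_measure0 (mu := mu) (B := ~` X1)) X10.
  - by apply: (measurable_preim mrelabel); exact: measurableC.
  - exact: measurableC.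
  - by move=> z nX2 /relabelX2.
exists X1, X2, (@relabel K), (@unrelabel K); split.
- by [].
- by [].
- split=> //.
  + by move=> w [pw bw]; exact: perfect_unrelabel.
  + by move=> z; exact: unrelabel_relabel.
  + by move=> w [pw bw]; exact: relabel_unrelabel.
- by split; apply: measurable_funTS => //; exact: measurable_unrelabel.
split=> [B mB|z Xz].
  have mrB : measurable (@relabel_map _ K @^-1` B) by exact: (measurable_preim mrelabel).
  transitivity (mu (@relabel_map _ K @^-1` B)).
    by apply: (measure_eq_on (N := X1)) => //; [exact: measurableI|move=> z Xz; split=> [[]|]].
  rewrite [LHS](relabel_lawE kappa mB).
  apply: (measure_eq_on (N := X2)) => //; first exact: measurableI.
  by move=> w Xw; split=> [|[]].
apply/seteqP; split=> [_ [_ [[g _ <-] Xg] <-]|_ [[g _ <-] Xg]].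
  split; last exact: relabelX2.
  (* Acting by [g] on [z] moves the root to [g^-1], which is [rewire z u] for
     [u = unrewire (relabel z) g^-1]; the relabelling is then shifted by [u^-1]. *)
  exists (unrewire (relabel z) g^-1%g)^-1%g => //.
  have := relabel_translate (unrewire (relabel z) g^-1%g) Xz.
  by rewrite unrewireK// => ->; apply/funext => f; rewrite /= /Defs.shift invgK.
have e := relabel_translate g^-1%g Xz.
exists (fun f => z (rewire z (g^-1) * f)%g); last exact: e.
split; last exact/perfect_edges_translate.
by exists (rewire z g^-1%g)^-1%g => //; apply/funext => f; rewrite /= /Defs.shift invgK.
Qed.
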